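(* In the functional linear model with Gaussian errors described in the context, consider the adaptive test of $H_0:\beta=0$ that, for a given level $\bar\alpha\in(0,1)$, rejects $H_0$ when $AT_n>c_{\bar\alpha}$, $c_{\bar\alpha}=-\log(-\log(1-\bar\alpha))$. Let $k\ge1$ be a fixed but unknown integer and $\delta(n,k)=n^{-2k/(4k+1)}(\log\log n)^{k/(4k+1)}$. Suppose $k_n\asymp(\log n)^{d_0}$ for some constant $d_0\in(0,1/2)$. Then for any $\varepsilon\in(0,1)$ there exist positive constants $N_\varepsilon$ and $C_\varepsilon$ such that for any $n\ge N_\varepsilon$, $$\inf_{\substack{\|\mathfrak b\|_{\ell^2}\ge C_\varepsilon\delta(n,k)\\ \|\mathfrak b\|_{k,\ell^2}\le1}}P_{\mathfrak b}(\text{reject }H_0)\ge1-\varepsilon,$$ the infimum being over real sequences $\mathfrak b=\{b_\nu\}_{\nu\ge1}$.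
   Context: Model: $Y_i=\int_0^1X_i(t)\beta(t)dt+\epsilon_i$, $i=1,\dots,n$, with i.i.d. observations, $X_i$ a zero-mean random process on $[0,1]$ independent of the error $\epsilon_i$, and $\epsilon_i\sim N(0,1)$. Empirical eigenfunctions: let $\widehat C(s,t)=n^{-1}\sum_{i=1}^nX_i(s)X_i(t)$, $\widehat V(\beta,\tilde\beta)=\int_0^1\int_0^1\widehat C(s,t)\beta(s)\tilde\beta(t)dsdt$, and let $\widehat\varphi_\nu$, $\nu\ge1$, be a sequence of functions on $[0,1]$, constructed from $X_1,\dots,X_n$, with $\widehat V(\widehat\varphi_\nu,\widehat\varphi_\mu)=\delta_{\nu\mu}$ for all $\nu,\mu\ge1$. Put $\omega_{i\nu}=\int_0^1X_i(t)\widehat\varphi_\nu(t)dt$ for $i=1,\dots,n$, $\nu\ge1$, and $\Omega=(\omega_{i\nu})_{1\le i,\nu\le n}$, so that $\Omega^T\Omega=nI_n$. Alternatives: for a real sequence $\mathfrak b=\{b_\nu\}_{\nu\ge1}$, $\|\mathfrak b\|_{\ell^2}^2=\sum_{\nu=1}^\infty b_\nu^2$, $\|\mathfrak b\|_{k,\ell^2}^2=\sum_{\nu=1}^\infty b_\nu^2\nu^{2k}$, $\beta_{\mathfrak b}=\sum_{\nu=1}^\infty b_\nu\widehat\varphi_\nu$, and $P_{\mathfrak b}$ is the probability measure corresponding to the slope function $\beta=\beta_{\mathfrak b}$. Thus the constraint $\|\mathfrak b\|_{k,\ell^2}\le1$ says that $\beta_{\mathfrak b}$ lies in $\mathcal B_{k,1}=\{\sum_{\nu=1}^\infty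 b_\nu\widehat\varphi_\nu:\sum_{\nu=1}^\infty b_\nu^2\nu^{2k}\le1\}$. Test statistic: for integers $j\ge1$, let $\lambda_j=c_0^{2j}n^{-4j/(4j+1)}(\log\log n)^{2j/(4j+1)}$ with a constant $c_0>0$ not depending on $j$, $\Lambda_j=\mathrm{diag}(1^{2j},2^{2j},\dots,n^{2j})$, $d_\nu(j)=1/(1+\lambda_j\nu^{2j})$. With $Y=(Y_1,\dots,Y_n)^T$, the penalized likelihood ratio statistic is $\mathrm{PLRT}_j=-\frac1{2n}Y^T\Omega(nI_n+n\lambda_j\Lambda_j)^{-1}\Omega^TY$, and $$\tau_j=\frac{-2n\,\mathrm{PLRT}_j-\sum_{\nu=1}^nd_\nu(j)}{(2\sum_{\nu=1}^nd_\nu(j)^2)^{1/2}},\qquad AT_n^*=\max_{1\le j\le k_n}\tau_j,\qquad AT_n=B_n(AT_n^*-B_n),$$ where $B_n$ satisfies $2\pi B_n^2\exp(B_n^2)=k_n^2$. The notation $k_n\asymp(\log n)^{d_0}$ means that the ratio is bounded between two positive constants.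
   Formalization: Orthonormality of the empirical eigenfunctions for all ν,μ≥1 is impossible since V̂ has rank at most n; it is assumed only for ν,μ≤n (so Ω^TΩ=nI_n), with V̂(φ̂_ν,φ̂_ν)≤1 for ν>n, and the series for β_b is taken to converge in the V̂-seminorm. *)

(* Defs.v *)
From HB Require Import structures.
From mathcomp Require Import all_boot all_order all_algebra.
From mathcomp Require Import all_classical all_reals all_analysis.

Set Implicit Arguments.
Unset Strict Implicit.
Unset Printing Implicit Defensive.

Import Order.TTheory GRing.Theory Num.Theory.
Import numFieldNormedType.Exports.

Local Open Scope classical_set_scope.
Local Open Scope ring_scope.

(* Observations are indexed from 0: X i, eps i (i < n) stand for X_{i+1},
   epsilon_{i+1}.  Eigenfunctions, coefficients and penalty orders
   keep their indices nu >= 1, j >= 1; values at index 0 are never used.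
   A process is a map T -> R -> R, (w, t) |-> X w t, of which only the
   restriction to t in [0, 1] matters. *)

Section independence.
Context d (T : measurableType d) (R : realType) (P : probability T R).

Definition indep_pair (F G : set (set T)) : Prop :=
  forall A B, F A -> G B -> P (A `&` B) = (P A * P B)%E.

Definition mutual_indep (F : nat -> set (set T)) : Prop :=
  forall (J : seq nat) (A : nat -> set T), uniq J ->
    (forall i, i \in J -> F i (A i)) ->
    P (\bigcap_(i in [set` J]) A i) = (\prod_(i <- J) P (A i))%E.

End independence.

Section processes.
Context d (T : measurableType d) (R : realType) (P : probability T R).

Definition coord_events (X : T -> R -> R) : set (set T) :=
  [set A | exists t B, [/\ t \in `[0, 1], measurable B &
                           A = (fun w => X w t) @^-1` B]].

(* The joint map (w, t) |-> X w t is measurable on T x [0, 1], where T carries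
   the sigma-algebra generated by G. *)
Definition process_measurable (G : set (set T)) (X : T -> R -> R) : Prop :=
  measurable_fun ([set: g_sigma_algebraType G] `*` (`[0, 1]%classic : set R))
    (fun p : (g_sigma_algebraType G * R)%type => X p.1 p.2 : R).

Definition same_process_law (X Y : T -> R -> R) : Prop :=
  forall (m : nat) (t : 'I_m -> R) (B : 'I_m -> set R),
    (forall l, t l \in `[0, 1]) -> (forall l, measurable (B l)) ->
    P (\bigcap_(l in [set: 'I_m]) (fun w => X w (t l)) @^-1` B l) =
    P (\bigcap_(l in [set: 'I_m]) (fun w => Y w (t l)) @^-1` B l).

Definition zero_mean (X : T -> R -> R) : Prop :=
  forall t, t \in `[0, 1] ->
    P.-integrable setT (EFin \o (fun w => X w t)) /\
    ('E_P[fun w => X w t] = 0)%E.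

(* The pairs (X_i, eps_i) are i.i.d., X_i is a zero-mean measurable process
   independent of eps_i, and eps_i ~ N(0, 1).  The common law of the pairs is
   determined by that of X_i, since X_i and eps_i are independent. *)
Definition flm_design (X : nat -> T -> R -> R) (eps : nat -> {RV P >-> R}) :
    Prop :=
  [/\ forall i, process_measurable (coord_events (X i)) (X i),
      forall i, zero_mean (X i),
      forall i, same_process_law (X i) (X 0%N),
      mutual_indep P
        (fun i => <<s coord_events (X i) `|` g_sigma_algebra_preimage (eps i) >>)
    & forall i, indep_pair P <<s coord_events (X i) >>
                             (g_sigma_algebra_preimage (eps i)) /\
                (forall A, measurable A ->
                   distribution P (eps i) A = normal_prob 0 1 A)].

Definition sample_events (X : nat -> T -> R -> R) (n : nat) : set (set T) :=
  \bigcup_(i in `I_n) coord_events (X i).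

End processes.

Section functional_linear_model.
Context (T : Type) (R : realType).
Implicit Types (X : nat -> T -> R -> R) (n : nat) (w : T) (f g : R -> R).

Definition inner01 f g : R :=
  \int[lebesgue_measure]_(t in `[0, 1]) (f t * g t).

Definition integrable01 f : Prop :=
  lebesgue_measure.-integrable `[0, 1] (EFin \o f).

Definition Chat X n w (s t : R) : R :=
  n%:R^-1 * \sum_(i < n) X i w s * X i w t.

Definition Vhat X n w f g : R :=
  \int[lebesgue_measure]_(s in `[0, 1])
    \int[lebesgue_measure]_(t in `[0, 1]) (Chat X n w s t * f s * g t).

(* Omega is indexed by 'I_n x 'I_n, so column nu holds the eigenfunction of
   index nu + 1; phi is the sequence (phi_nu) at a given sample size. *)
Definition Omega X n (phi : nat -> T -> R -> R) w : 'M[R]_n :=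
  \matrix_(i < n, nu < n) inner01 (X i w) (phi nu.+1 w).

Definition responses X n (eps : nat -> T -> R) (beta : T -> R -> R) w :
    'cV[R]_n :=
  \col_(i < n) (inner01 (X i w) (beta w) + eps i w).

End functional_linear_model.

Section eigenfunctions.
Context d (T : measurableType d) (R : realType) (P : probability T R).

(* phi_nu, nu >= 1, is built from X_1, ..., X_n.  Vhat has rank at most n, so
   Vhat(phi_nu, phi_mu) = delta_{nu mu} cannot hold for all nu, mu >= 1: only
   n of the phi_nu can be orthonormal.  We require orthonormality for
   nu, mu <= n (that is, Omega^T Omega = n I_n), and for nu > n only the upper
   bound Vhat(phi_nu, phi_nu) <= 1, which is implied by orthonormality as well
   as by the convention that the remaining phi_nu span the kernel of Vhat. *)
Definition empirical_eigenfunctions (X : nat -> T -> R -> R) (n : nat)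
    (phi : nat -> T -> R -> R) : Prop :=
  (forall nu, (1 <= nu)%N -> process_measurable (sample_events X n) (phi nu)) /\
  {ae P, forall w,
    [/\ forall i nu, (i < n)%N -> (1 <= nu)%N ->
          integrable01 (fun t => X i w t * phi nu w t),
        forall nu mu, (1 <= nu <= n)%N -> (1 <= mu <= n)%N ->
          Vhat X n w (phi nu w) (phi mu w) = (nu == mu)%:R
      & forall nu, (n < nu)%N -> Vhat X n w (phi nu w) (phi nu w) <= 1]}.

(* beta = sum_{nu >= 1} b_nu phi_nu, the series converging for the seminorm
   Vhat(f, f)^{1/2} = (n^{-1} sum_i (int X_i f)^2)^{1/2}.  Two sums of the same
   series give the same integrals of X_i beta, hence the same responses, almost
   surely. *)
Definition slope_sum (X : nat -> T -> R -> R) (n : nat)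
    (phi : nat -> T -> R -> R) (b : nat -> R) (beta : T -> R -> R) : Prop :=
  measurable_fun ([set: T] `*` (`[0, 1]%classic : set R))
    (fun p : (T * R)%type => beta p.1 p.2 : R) /\
  {ae P, forall w,
    (forall i, (i < n)%N -> integrable01 (fun t => X i w t * beta w t)) /\
    (let rest m t := beta w t - \sum_(1 <= nu < m.+1) b nu * phi nu w t in
     (fun m => Vhat X n w (rest m) (rest m)) @ \oo --> (0 : R))}.

End eigenfunctions.

Section sequences_and_rates.
Context (R : realType).
Implicit Types (b : nat -> R) (n k : nat).

Definition l2norm b : \bar R :=
  sqrte (\sum_(1 <= nu <oo) (b nu ^+ 2)%:E)%E.

Definition l2norm_wt k b : \bar R :=
  sqrte (\sum_(1 <= nu <oo) (b nu ^+ 2 * nu%:R ^+ (2 * k))%:E)%E.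

Definition delta n k : R :=
  n%:R `^ (- (2 * k)%:R / (4 * k + 1)%:R) *
  ln (ln n%:R) `^ (k%:R / (4 * k + 1)%:R).

Definition asymp_eq (u v : nat -> R) : Prop :=
  exists c C : R, [/\ 0 < c, 0 < C &
    \forall n \near \oo, c * v n <= u n <= C * v n].

End sequences_and_rates.

Section test_statistic.
Context (R : realType) (c0 : R) (n : nat).
Implicit Types (j : nat) (Om : 'M[R]_n) (Y : 'cV[R]_n).

Definition lambda_ j : R :=
  c0 ^+ (2 * j) * n%:R `^ (- (4 * j)%:R / (4 * j + 1)%:R) *
  ln (ln n%:R) `^ ((2 * j)%:R / (4 * j + 1)%:R).

Definition Lambda_ j : 'M[R]_n :=
  diag_mx (\row_(nu < n) (nu.+1)%:R ^+ (2 * j)).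

Definition dpen j (nu : nat) : R := (1 + lambda_ j * nu%:R ^+ (2 * j))^-1.

Definition PLRT j Om Y : R :=
  - (2 * n%:R)^-1 *
  (Y^T *m Om *m invmx ((n%:R)%:M + (n%:R * lambda_ j) *: Lambda_ j)
     *m Om^T *m Y) 0 0.

Definition tau j Om Y : R :=
  (- (2 * n%:R * PLRT j Om Y) - \sum_(1 <= nu < n.+1) dpen j nu) /
  Num.sqrt (2 * \sum_(1 <= nu < n.+1) dpen j nu ^+ 2).

(* For kn >= 1 the base value tau_1 is one of the terms, so this is the
   maximum of tau_1, ..., tau_kn. *)
Definition ATstar (kn : nat) Om Y : R :=
  \big[Num.max/tau 1 Om Y]_(1 <= j < kn.+1) tau j Om Y.

Definition AT (kn : nat) (Bn : R) Om Y : R := Bn * (ATstar kn Om Y - Bn).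

Definition crit (alpha : R) : R := - ln (- ln (1 - alpha)).

End test_statistic.

(* The event that the adaptive test rejects when the data follow the model with
   slope beta; its P-probability is the rejection probability under that
   slope. *)
Definition reject (T : Type) (R : realType) (X : nat -> T -> R -> R)
    (eps : nat -> T -> R) (n : nat) (phi : nat -> T -> R -> R) (c0 : R)
    (kn : nat) (Bn alpha : R) (beta : T -> R -> R) : set T :=
  [set w | crit alpha <
           AT c0 kn Bn (Omega X n phi w) (responses X n eps beta w)].

(* Main.v *)
(* Fix [j = k].  In the rotated coordinates [z = U^T Y], [U = Omega / sqrt n], the
   statistic [- 2 n PLRT_k - sum d_nu] is [sum d_nu (z_nu^2 - 1)] with
   [z_nu = sqrt n b_nu + r_nu + eta_nu]: a deterministic signal, a remainder
   of bounded norm coming from the [b_nu] with [nu > n] (Cauchy-Schwarz against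
   [1 / nu^2]), and the rotated noise [eta = U^T eps].  The signal contributes
   [S = n sum d_nu b_nu^2], which the choice of [lambda_k] makes at least a large
   multiple of [n delta^2].  The noise contributes a linear form and a centred
   quadratic form in [eps]; their coefficients depend on [X] only, so they are
   sums of pairwise orthogonal terms, with variances of order [S] and
   [sum d_nu^2], and Chebyshev's inequality controls them.  No law of [eta] is
   needed, only the moments of [eps].  Since [sum d_nu^2 * log log n] is of order
   [(n delta^2)^2] and [B_n] of order [sqrt (log log n)], the signal dominates
   the rejection threshold. *)

Require Import Defs.
From HB Require Import structures.
From mathcomp Require Import all_boot all_order all_algebra.
From mathcomp Require Import all_classical all_reals all_analysis.
From mathcomp Require Import measurable_realfun ring lra.

Set Implicit Arguments.
Unset Strict Implicit.
Unset Printing Implicit Defensive.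

Import Order.TTheory GRing.Theory Num.Theory.
Import numFieldNormedType.Exports.

Local Open Scope classical_set_scope.
Local Open Scope ring_scope.

(** * Independence *)

(** The obstacle is that the coefficients of the forms in [eps] are random, functions of the whole
    sample of processes. The moment computations survive because each single error is independent of
    the sigma-algebra generated by all the processes and the other errors. The model only gives
    independence between the pairs (X_i, eps_i) and inside each pair, so this has to be derived. In
    a product of two distinct terms of a form some error then enters only through a factor of mean
    zero, and the expectation vanishes.

    Uniformity over the alternatives comes from measuring deviations on the scale of the second
    moments: the exceptional event has probability at most kappa / s with kappa absolute, whatever
    the slope, so s = kappa / e settles the level.

    With h = lambda_k^(1/(2k)) and x = n delta^2, the penalty balances the loss from damping, n
    lambda_k = c0^(2k) x, against the noise, sum d_nu^2 <= 3 / h. The power of log log n in lambda_k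
    is the one for which (log log n) / h = x^2 / c0, so that the factor B_n in the threshold is paid
    for. *)

Section product_rule.
Context d (T : measurableType d) (R : realType) (P : probability T R).
Variables (G : set (set T)) (Y : {RV P >-> R}).
Hypothesis GM : G `<=` measurable.
Hypothesis GY : indep_pair P <<s G >> (g_sigma_algebra_preimage Y).

Local Notation S := (g_sigma_algebraType G).

Lemma sub_gen_measurable : <<s G >> `<=` @measurable _ T.
Proof. by apply: smallest_sub => //; exact: sigma_algebra_measurable. Qed.

Lemma measurable_fun_gen d' (T' : measurableType d') (f : T -> T') :
  measurable_fun setT (f : S -> T') -> measurable_fun setT f.
Proof.
move=> mf _ A mA; have := mf measurableT A mA.
exact: sub_gen_measurable.
Qed.

(** A sigma-algebra is treated as a random variable, the identity map into [S]. Independence of [G]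
    and [Y] then says that the pair has a product law, and Fubini's theorem takes the place of
    conditioning on the sample. *)
Let J (w : T) : S * R := (w, Y w).

Let mid : measurable_fun setT (idfun : T -> S).
Proof. by move=> _ A mA; rewrite setTI; exact: sub_gen_measurable. Qed.

Let mJ : measurable_fun setT J.
Proof. by apply: measurable_fun_pair => //. Qed.

Let iotaf : {mfun T >-> S} :=
  HB.pack (idfun : T -> S) (isMeasurableFun.Build _ _ _ _ _ mid).
Let Jf : {mfun T >-> (S * R)%type} :=
  HB.pack J (isMeasurableFun.Build _ _ _ _ _ mJ).

Let joint_law A : measurable A ->
  distribution P Jf A = (distribution P iotaf \x distribution P Y)%E A.
Proof.
move=> mA; apply/esym.
apply: product_measure_unique => // B C mB mC.
rewrite /= /distribution /pushforward /=.
have -> : J @^-1` (B `*` C) = B `&` (Y @^-1` C) by [].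
apply: GY => //.
by exists C => //; rewrite setTI.
Qed.

Lemma ge0_integral_indep (f : S * R -> \bar R) :
  measurable_fun setT f -> (forall z, 0 <= f z)%E ->
  (\int[P]_w f (w, Y w) = \int[P]_w \int[distribution P Y]_y f (w, y))%E.
Proof.
move=> mf f0.
transitivity (\int[distribution P Jf]_z f z)%E.
  by rewrite ge0_integral_distribution.
transitivity (\int[(distribution P iotaf \x distribution P Y)%E]_z f z)%E.
  by apply: eq_measure_integral => A mA _; exact: joint_law.
rewrite fubini_tonelli1//.
rewrite ge0_integral_distribution//.
- exact: measurable_fun_fubini_tonelli_F.
- by move=> y; apply: integral_ge0.
Qed.

Lemma ge0_integral_indepM (f g : T -> R) (h : R -> R) :
  measurable_fun setT (f : S -> R) -> measurable_fun setT h ->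
  (forall w, 0 <= f w) -> (forall y, 0 <= h y) ->
  (\int[P]_w (f w * h (Y w))%:E =
   \int[P]_w (f w)%:E * \int[distribution P Y]_y (h y)%:E)%E.
Proof.
move=> mf mh f0 h0.
have /= -> := @ge0_integral_indep (fun z => (f z.1 * h z.2)%:E).
- under eq_integral => w _.
    under eq_integral => y _ do rewrite EFinM.
    rewrite ge0_integralZl//; [over|exact/measurable_EFinP|by move=> y _; rewrite lee_fin|by rewrite lee_fin].
  rewrite ge0_integralZr//.
  + by apply/measurable_EFinP; exact: measurable_fun_gen mf.
  + by move=> w _; rewrite lee_fin.
  + by apply: integral_ge0 => y _; rewrite lee_fin.
- apply/measurable_EFinP; apply: measurable_funM.
  + by apply: (measurableT_comp mf); exact: measurable_fst.
  + by apply: (measurableT_comp mh); exact: measurable_snd.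
- by move=> z; rewrite lee_fin mulr_ge0.
Qed.

(** Integrability comes from the product rule for absolute values; the integral vanishes because the
    inner integral over [y] is [f w] times the mean of [h]. *)
Lemma integral_indepM_eq0 (f : T -> R) (h : R -> R) :
  measurable_fun setT (f : S -> R) -> measurable_fun setT h ->
  P.-integrable setT (fun w => (f w)%:E) ->
  (distribution P Y).-integrable setT (fun y => (h y)%:E) ->
  (\int[distribution P Y]_y (h y)%:E = 0)%E ->
  P.-integrable setT (fun w => (f w * h (Y w))%:E) /\
  (\int[P]_w (f w * h (Y w))%:E = 0)%E.
Proof.
move=> mf mh fi hi h0.
have mg : measurable_fun setT (fun z : S * R => (f z.1 * h z.2)%:E).
  apply/measurable_EFinP; apply: measurable_funM.
  + by apply: (measurableT_comp mf); exact: measurable_fst.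
  + by apply: (measurableT_comp mh); exact: measurable_snd.
have mfT : measurable_fun setT f by exact: measurable_fun_gen mf.
have fY : P.-integrable setT (fun w => (f w * h (Y w))%:E).
  apply/integrableP; split.
    apply/measurable_EFinP; apply: measurable_funM => //.
    exact: measurableT_comp.
  under eq_integral do rewrite abse_EFin normrM.
  rewrite (@ge0_integral_indepM (fun w => `|f w|) f (fun y => `|h y|))//=; last 2 first.
    exact: measurableT_comp.
    exact: measurableT_comp.
  rewrite lte_mul_pinfty//.
  - by apply: integral_ge0.
  - by rewrite ge0_fin_numE ?integral_ge0//; case/integrableP : fi.
  - by case/integrableP : hi.
split => //.
transitivity (\int[distribution P Jf]_z (f z.1 * h z.2)%:E)%E.
  by rewrite integral_distribution.
transitivity (\int[(distribution P iotaf \x distribution P Y)%E]_z (f z.1 * h z.2)%:E)%E.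
  by apply: eq_measure_integral => A mA _; exact: joint_law.
(* Integrability under the product law is read back from integrability under [P], by the rule for
   nonnegative functions. *)
have fJ : (distribution P iotaf \x distribution P Y)%E.-integrable setT
    (fun z => (f z.1 * h z.2)%:E).
  apply/integrable12ltyP => //.
  have mg' : measurable_fun setT (fun z : S * R => `|(f z.1 * h z.2)%:E|%E).
    exact: measurableT_comp.
  have mF := @measurable_fun_fubini_tonelli_F _ _ _ _ _ (distribution P Y) _ mg'.
  rewrite (@ge0_integral_distribution _ _ _ _ _ P iotaf)//; last 2 first.
  - by apply: mF.
  - by move=> y; apply: integral_ge0.
  rewrite -(@ge0_integral_indep (fun z : S * R => `|(f z.1 * h z.2)%:E|%E))//.
  by case/integrableP : fY.
rewrite -integral12_prod_meas1//.
rewrite /fubini_F/=.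
rewrite integral0_eq// => w _ /=.
under eq_integral do rewrite EFinM.
by rewrite integralZl// h0 mule0.
Qed.

End product_rule.

(** * Independence of one error from the rest of the sample *)

Section independence_of_the_rest.
Context d (T : measurableType d) (R : realType) (P : probability T R).

(** For fixed [B], both P(A and B) and P(A) P(B) are finite measures in [A]. They agree on the
    pi-system [G], hence on the sigma-algebra that it generates. *)
Lemma indep_pair_pi (G : set (set T)) (H : set (set T)) :
  G `<=` measurable -> H `<=` measurable -> setI_closed G -> G setT ->
  indep_pair P G H -> indep_pair P <<s G >> H.
Proof.
move=> GM HM GI GT GH A B sA HB.
have mB : measurable B by exact: HM.
have PB0 : 0 <= fine (P B) by rewrite fine_ge0.
pose m2 := mscale (NngNum PB0) P.
have E C : m2 C = (P C * P B)%E.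
  by rewrite /m2 /mscale/= fineK ?fin_num_measure// muleC.
rewrite -E -[LHS]/(mrestr P mB A).
have := @g_sigma_algebra_measure_unique _ R T G GM (fun=> setT) _ _ (mrestr P mB) m2.
apply => //.
- by rewrite bigcup_const//; exists 0%N.
- by move=> C GC; rewrite /= /mrestr GH//; exact/esym/E.
- by move=> k; rewrite /= /mrestr setTI ltey_eq fin_num_measure.
Qed.

Variables (X : nat -> T -> R -> R) (eps : nat -> {RV P >-> R}).
Hypothesis XE : flm_design X eps.

Lemma coord_events_measurable i : coord_events (X i) `<=` measurable.
Proof.
move=> _ [t [B [t01 mB ->]]].
have [_ zm _ _ _] := XE.
have [/measurable_int/measurable_EFinP mX _] := zm i t t01.
by rewrite -[_ @^-1` _]setTI; exact: mX.
Qed.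

(* A pi-system generating the sigma-algebra of the first [n] observations with
   the single error [eps j] left out. *)
Definition rest_events (n j : nat) : set (set T) :=
  [set C | exists A : nat -> set T,
    (forall i, (i < n)%N -> if i == j then <<s coord_events (X j) >> (A i)
      else <<s coord_events (X i) `|` g_sigma_algebra_preimage (eps i) >> (A i)) /\
    C = \bigcap_(i in [set` iota 0 n]) A i].

Lemma preimage_measurable i : g_sigma_algebra_preimage (eps i) `<=` measurable.
Proof. by move=> _ [B mB <-]; rewrite setTI; exact: measurable_funPTI. Qed.

Lemma pair_events_measurable i :
  <<s coord_events (X i) `|` g_sigma_algebra_preimage (eps i) >> `<=` measurable.
Proof.
apply: smallest_sub; first exact: sigma_algebra_measurable.
by move=> A [|]; [exact: coord_events_measurable|exact: preimage_measurable].
Qed.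

Lemma sub_pair_events i : <<s coord_events (X i) >> `<=`
  <<s coord_events (X i) `|` g_sigma_algebra_preimage (eps i) >>.
Proof. apply: sub_sigma_algebra2; exact: subsetUl. Qed.

Lemma rest_events_sub n j C : rest_events n j C -> exists A : nat -> set T,
  [/\ forall i, (i < n)%N ->
    <<s coord_events (X i) `|` g_sigma_algebra_preimage (eps i) >> (A i),
    (j < n)%N -> <<s coord_events (X j) >> (A j) &
    C = \bigcap_(i in [set` iota 0 n]) A i].
Proof.
move=> [A [hA ->]]; exists A; split => //.
- move=> i ilt; have := hA i ilt; case: eqVneq => // ->.
  exact: sub_pair_events.
- by move=> /hA; rewrite eqxx.
Qed.

Lemma rest_events_measurable n j : rest_events n j `<=` measurable.
Proof.
move=> C /rest_events_sub[A [hA _ ->]].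
rewrite bigcap_mkcond; apply: bigcapT_measurable => i.
case: ifPn => //; rewrite inE/= mem_iota add0n => /hA.
exact: pair_events_measurable.
Qed.

Lemma rest_eventsI n j : setI_closed (rest_events n j).
Proof.
move=> _ _ [A [hA ->]] [B [hB ->]]; exists (fun i => A i `&` B i); split.
  move=> i ilt; have := hA i ilt; have := hB i ilt.
  by case: eqP => _ ? ?;
     apply: (@measurableI _ (g_sigma_algebraType _)).
by rewrite bigcapI.
Qed.

Lemma rest_eventsW n j i A : (i < n)%N ->
  (if i == j then <<s coord_events (X j) >> A
   else <<s coord_events (X i) `|` g_sigma_algebra_preimage (eps i) >> A) ->
  rest_events n j A.
Proof.
move=> ilt hA; exists (fun l => if l == i then A else setT); split.
  move=> l llt; have [->//|_] := eqVneq l i.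
  by case: ifP => _; exact: (@measurableT _ (g_sigma_algebraType _)).
apply/seteqP; split => [w Aw l _|w /(_ i)] /=; first by case: ifP.
by rewrite mem_iota/= add0n eqxx; exact.
Qed.

(** Intersecting with an event [B] of [eps j] changes only the component of index [j], from [A j] to
    [A j] and [B]. Mutual independence factors both intersections over the indices, and inside the
    pair of index [j] the event [A j] concerns the process alone. *)
Lemma rest_indep n j : (j < n)%N ->
  indep_pair P <<s rest_events n j >> (g_sigma_algebra_preimage (eps j)).
Proof.
move=> jn; have [_ _ _ mi ip] := XE.
apply: indep_pair_pi.
- exact: rest_events_measurable.
- exact: preimage_measurable.
- exact: rest_eventsI.
- apply: (rest_eventsW jn); rewrite eqxx.
  exact: (@measurableT _ (g_sigma_algebraType _)).
move=> _ B /rest_events_sub[A [hA hAj ->]] HB.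
have jin : j \in iota 0 n by rewrite mem_iota.
have -> : \bigcap_(i in [set` iota 0 n]) A i `&` B =
    \bigcap_(i in [set` iota 0 n]) (if i == j then A j `&` B else A i).
  apply/seteqP; split => w /=.
    move=> [hw Bw] i iin; case: eqP => [_|_]; last exact: hw.
    by split => //; exact: hw.
  move=> hw; split => [i iin|].
    by have := hw _ iin; case: eqP => [-> []|].
  by have := hw _ jin; rewrite eqxx => -[].
rewrite (mi _ _ (iota_uniq 0 n)); last first.
  move=> i; rewrite mem_iota add0n => ilt.
  case: eqP => [->|_]; last exact: hA.
  apply: (@measurableI _ (g_sigma_algebraType _)).
    by apply: sub_pair_events; exact: hAj.
  by apply: sub_sigma_algebra; right.
rewrite (mi _ _ (iota_uniq 0 n)); last first.
  by move=> i; rewrite mem_iota add0n => ilt; exact: hA.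
rewrite (perm_big _ (perm_to_rem jin)) (perm_big _ (perm_to_rem jin))/=.
rewrite !big_cons eqxx.
have [indj _] := ip j.
rewrite (indj _ _ (hAj jn) HB).
rewrite [RHS]muleAC; congr (_ * _)%E.
rewrite big_seq_cond [RHS]big_seq_cond; apply: eq_bigr => i.
by rewrite (rem_filter _ (iota_uniq 0 n)) mem_filter/= => /andP[/andP[/negPf->]].
Qed.

End independence_of_the_rest.

(** * Change of sigma-algebra and measurability of time integrals *)

Section sub_sigma_algebras.
Context (T : pointedType) (R : realType).
Variables (G1 G2 : set (set T)).
Hypothesis G12 : G1 `<=` <<s G2 >>.

Lemma sub_gen : <<s G1 >> `<=` <<s G2 >>.
Proof. by apply: smallest_sub. Qed.

Lemma measurable_fun_sub_gen d' (T' : measurableType d') (f : T -> T') :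
  measurable_fun setT (f : g_sigma_algebraType G1 -> T') ->
  measurable_fun setT (f : g_sigma_algebraType G2 -> T').
Proof. by move=> mf _ A mA; have := mf measurableT A mA; exact: sub_gen. Qed.

Lemma process_measurable_sub (Z : T -> R -> R) :
  measurable_fun ([set: g_sigma_algebraType G1] `*` (`[0, 1]%classic : set R))
    (fun p : (g_sigma_algebraType G1 * R)%type => Z p.1 p.2 : R) ->
  measurable_fun ([set: g_sigma_algebraType G2] `*` (`[0, 1]%classic : set R))
    (fun p : (g_sigma_algebraType G2 * R)%type => Z p.1 p.2 : R).
Proof.
move=> mZ.
pose F (p : (g_sigma_algebraType G1 * R)%type) : R := Z p.1 p.2.
pose g (p : (g_sigma_algebraType G2 * R)%type) : (g_sigma_algebraType G1 * R)%type :=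
  (p.1 : g_sigma_algebraType G1, p.2).
apply: (@measurable_comp _ _ _ _ _ _ _ F _ g) mZ _.
- by apply: measurableX => //; exact: measurableT.
- by move=> _ [[w t] [_ t01] <-].
- apply: measurable_funTS; apply: measurable_fun_pair => //.
  apply: (@measurableT_comp _ _ _ _ _ _ (idfun : g_sigma_algebraType G2 -> g_sigma_algebraType G1)).
    by move=> _ A mA; rewrite setTI; exact: sub_gen.
  exact: measurable_fst.
Qed.

End sub_sigma_algebras.

(** Tonelli's theorem is applied separately to the positive and the negative part of the product,
    extended by 0 outside [0, 1]. *)
Lemma measurable_inner01 d (T : measurableType d) (R : realType)
    (f g : T -> R -> R) :
  measurable_fun ([set: T] `*` (`[0, 1]%classic : set R))
    (fun p : (T * R)%type => f p.1 p.2) ->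
  measurable_fun ([set: T] `*` (`[0, 1]%classic : set R))
    (fun p : (T * R)%type => g p.1 p.2) ->
  measurable_fun setT (fun w => inner01 (f w) (g w)).
Proof.
move=> mf mg.
pose D := [set: T] `*` (`[0, 1]%classic : set R).
have mD : measurable D by apply: measurableX.
pose h : (T * R)%type -> \bar R := (fun p => (f p.1 p.2 * g p.1 p.2)%:E) \_ D.
have mh : measurable_fun setT h.
  apply/(measurable_restrictT _ mD); apply/measurable_EFinP.
  exact: measurable_funM.
rewrite /inner01 /Rintegral.
have E w : (\int[lebesgue_measure]_(t in (`[0%R, 1%R]%classic : set R)) (f w t * g w t)%:E =
    \int[lebesgue_measure]_t (h^\+ (w, t)) - \int[lebesgue_measure]_t (h^\- (w, t)))%E.
  rewrite integral_mkcond.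
  rewrite (_ : _ \_ _ = h \o pair w); last first.
    by apply/funext => t; rewrite /h /= /patch in_setX in_setT.
  by rewrite integralE funepos_comp funeneg_comp.
under eq_fun do rewrite E.
apply: measurableT_comp => //.
apply: emeasurable_funB.
- apply: (@measurable_fun_fubini_tonelli_F _ _ _ _ _ lebesgue_measure (h^\+)%E).
  + exact: measurable_funepos.
  + by move=> x; exact: funepos_ge0.
- apply: (@measurable_fun_fubini_tonelli_F _ _ _ _ _ lebesgue_measure (h^\-)%E).
  + exact: measurable_funeneg.
  + by move=> x; exact: funeneg_ge0.
Qed.

(** * Moments of the standard normal law *)

Section gaussian_moments.
Context (R : realType).
Notation mu := (@lebesgue_measure R).
Notation N01 := (@normal_prob R 0 1).
Notation g := (@normal_pdf R 0 1).

(** The change of variables is made with the Radon-Nikodym derivative, which equals the explicit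
    density almost everywhere because both have the same integral over every measurable set. *)
Lemma ge0_integral_normal (f : R -> \bar R) :
  measurable_fun setT f -> (forall x, 0 <= f x)%E ->
  (\int[N01]_x f x = \int[mu]_x (f x * (g x)%:E))%E.
Proof.
move=> mf f0; have dom := @normal_prob_dominates R 0 1.
rewrite -(Radon_Nikodym_SigmaFinite.change_of_variables dom)//.
have mh : mu.-integrable setT (Radon_Nikodym_SigmaFinite.f N01 mu).
  exact: Radon_Nikodym_SigmaFinite.f_integrable.
have mg : measurable_fun setT (fun x => (g x)%:E).
  by apply/measurable_EFinP; exact: measurable_normal_pdf.
apply: ae_eq_integral => //.
- by apply: emeasurable_funM => //; exact: measurable_int mh.
- exact: emeasurable_funM.
- apply: ae_eqe_mul2l; apply: integral_ae_eq => //.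
  move=> E _ mE; rewrite -Radon_Nikodym_SigmaFinite.f_integral//.
Qed.

Lemma normal_pdf01E (x : R) : g x = (Num.sqrt (pi *+ 2))^-1 * expR (- (x ^+ 2 / 2)).
Proof.
rewrite normal_pdfE ?oner_neq0//  /normal_peak /normal_fun subr0 expr1n mul1r.
by rewrite mulNr.
Qed.

Let c : R := (Num.sqrt (pi *+ 2))^-1.

Let c_ge0 : 0 <= c.
Proof. by rewrite invr_ge0. Qed.

(** The integrand is dominated by a multiple of the density with standard deviation 2. With y = x^2
    this reduces to y^2 exp(-3y/8) <= 64, which follows from (y/8) exp(-y/8) <= 1. *)
Lemma integral_normal_lty4 : (\int[N01]_x (x ^+ 4)%:E < +oo)%E.
Proof.
rewrite ge0_integral_normal//; last 2 first.
- by apply/measurable_EFinP; exact: measurable_funX.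
- by move=> x; rewrite lee_fin exprn_even_ge0.
have := @integral_normal_pdf R 0 2.
set p := (fun x => _) => ip.
pose K : R := 64 * (c / normal_peak 2).
have p20 : (0 : R) < normal_peak 2 by rewrite normal_peak_gt0.
have K0 : 0 <= K by rewrite mulr_ge0// mulr_ge0// invr_ge0 ltW.
apply: (@le_lt_trans _ _ (\int[mu]_x (K%:E * p x)))%E.
  apply: ge0_le_integral => //.
  - by move=> x _; rewrite mule_ge0 ?lee_fin ?exprn_even_ge0 ?normal_pdf_ge0.
  - apply: emeasurable_funM.
      by apply/measurable_EFinP; exact: measurable_funX.
    by apply/measurable_EFinP; exact: measurable_normal_pdf.
  - apply: emeasurable_funM => //.
    by apply/measurable_EFinP; exact: measurable_normal_pdf.
  - move=> x _; rewrite /p -!EFinM lee_fin normal_pdf01E -/c.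
    rewrite normal_pdfE// /normal_fun subr0.
    rewrite mulrA [_ * c]mulrC -mulrA.
    have -> : K * (normal_peak 2 * expR (- x ^+ 2 / (2 ^+ 2 *+ 2))) =
       c * (64 * expR (- x ^+ 2 / (2 ^+ 2 *+ 2))).
      by rewrite /K; field; rewrite gt_eqF.
    rewrite ler_wpM2l//.
    set y := x ^+ 2; have y0 : 0 <= y by rewrite sqr_ge0.
    have -> : x ^+ 4 = y ^+ 2 by rewrite -exprM.
    have -> : - y / (2 ^+ 2 *+ 2) = - (y / 8) by rewrite mulNr; congr (- (_ / _)); ring.
    have -> : - (y / 2) = - (y / 8) - (y / 8) - (y / 8) + - (y / 8) by field.
    rewrite !expRD mulrA ler_wpM2r ?expR_ge0//.
    have h : 1 + y / 8 <= expR (y / 8) by exact: expR_ge1Dx.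
    have e0 : 0 < expR (- (y / 8)) := expR_gt0 _.
    have e1 : expR (- (y / 8)) <= 1 by rewrite -expR0 ler_expR oppr_le0 divr_ge0.
    have he : y / 8 * expR (- (y / 8)) <= 1.
      rewrite expRN ler_pdivrMr ?expR_gt0// mul1r.
      by apply: le_trans h; rewrite lerDr.
    set z := expR _ in e0 e1 he *.
    have hz : 0 <= y / 8 * z by rewrite mulr_ge0 ?divr_ge0// ltW.
    have -> : y ^+ 2 * (z * z * z) = 64 * ((y / 8 * z) ^+ 2 * z) by field.
    rewrite ler_piMr// -[leRHS]mulr1 ler_pM ?sqr_ge0 ?(ltW e0)//.
    by rewrite -[leRHS](expr1n _ 2) ler_pXn2r// nnegrE.
rewrite ge0_integralZl// ?ip ?mule1 ?ltry//.
- by apply/measurable_EFinP; exact: measurable_normal_pdf.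
- by move=> x _; rewrite lee_fin normal_pdf_ge0.
Qed.

Lemma integral_normal_1Dx4_lty : (\int[N01]_x (1 + x ^+ 4)%:E < +oo)%E.
Proof.
under eq_integral do rewrite EFinD.
rewrite ge0_integralD//; last 2 first.
- by move=> x _; rewrite lee_fin exprn_even_ge0.
- by apply/measurable_EFinP; exact: measurable_funX.
rewrite integral_cst// mul1e lte_add_pinfty ?integral_normal_lty4//.
by rewrite (le_lt_trans (probability_le1 _ _)) ?ltry.
Qed.

(** Reflection exchanges the integrals of the positive and negative parts. Their difference is 0
    once they are finite, which follows by domination with 1 + x^4. *)
Lemma integral_normal1 : (\int[N01]_x x%:E = 0)%E.
Proof.
rewrite integralE.
have mid : measurable_fun setT (fun x : R => x%:E) by exact/measurable_EFinP.
rewrite ge0_integral_normal//; last exact: measurable_funepos.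
rewrite ge0_integral_normal//; last exact: measurable_funeneg.
set I := integral mu _ _; set J := integral mu _ _.
have IJ : I = J.
  transitivity (\int[pushforward mu (-%R : _ -> measurableTypeR R)]_x
      ((fun x : R => x%:E)^\+ x * (g x)%:E))%E.
    apply: eq_measure_integral => A mA _; exact/esym/lebesgue_measureN.
  rewrite ge0_integral_pushforward//=; last 2 first.
  - apply: emeasurable_funM; first exact: measurable_funepos.
    by apply/measurable_EFinP; exact: measurable_normal_pdf.
  - by move=> x _; rewrite mule_ge0// lee_fin normal_pdf_ge0.
  rewrite preimage_setT; apply: eq_integral => x _ /=.
  by rewrite !normal_pdf01E sqrrN funeposE funenegE EFinN.
have Jfin : (J \is a fin_num)%E.
  rewrite ge0_fin_numE; last first.
    by apply: integral_ge0 => x _; rewrite mule_ge0// lee_fin normal_pdf_ge0.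
  apply: le_lt_trans integral_normal_1Dx4_lty.
  rewrite [leRHS]ge0_integral_normal//; last 2 first.
  - by apply/measurable_EFinP; apply: measurable_funD => //; exact: measurable_funX.
  - by move=> x; rewrite lee_fin addr_ge0// exprn_even_ge0.
  apply: ge0_le_integral => //.
  - by move=> x _; rewrite mule_ge0// lee_fin normal_pdf_ge0.
  - apply: emeasurable_funM; first exact: measurable_funeneg.
    by apply/measurable_EFinP; exact: measurable_normal_pdf.
  - apply: emeasurable_funM.
      by apply/measurable_EFinP; apply: measurable_funD => //; exact: measurable_funX.
    by apply/measurable_EFinP; exact: measurable_normal_pdf.
  - move=> x _; rewrite lee_wpmul2r ?lee_fin ?normal_pdf_ge0//.
    rewrite funenegE -EFinN -EFin_max lee_fin ge_max.
    apply/andP; split; last by rewrite addr_ge0// exprn_even_ge0.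
    rewrite -subr_ge0.
    have -> : 1 + x ^+ 4 - - x = (x ^+ 2 - 1 / 2) ^+ 2 + (x + 1 / 2) ^+ 2 + 1 / 2 by field.
    by rewrite !addr_ge0 ?sqr_ge0 ?exprn_even_ge0 ?divr_ge0.
by rewrite IJ subee.
Qed.

Let Gf (x : R) : R := c * expR (- (x ^+ 2 / 2)).

Let gE : g = Gf.
Proof. by apply/funext => x; rewrite normal_pdf01E. Qed.

Let dG (x : R) : is_derive x 1 Gf (- (x * Gf x)).
Proof.
have h : is_derive x 1 (fun y : R => - (y ^+ 2 / 2)) (- x).
  have -> : (fun y : R => - (y ^+ 2 / 2)) = - (fun y : R => 2^-1 * y ^+ 2).
    by apply/funext => y; rewrite -[RHS]/(- (2^-1 * y ^+ 2)) mulrC.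
  apply: is_deriveN.
  have h2 : is_derive x 1 (fun y : R => y ^+ 2) (2%:R * x).
    have -> : (fun y : R => y ^+ 2) = id * id :> (R -> R) by apply/funext.
    apply: (is_derive_eq (@is_deriveM _ _ id id x 1 _ _ (is_derive_id _ _) (is_derive_id _ _))).
    by rewrite /GRing.scale/= mulr1 mulr2n mulrDl mul1r.
  apply: (is_derive_eq (@is_deriveZ _ _ _ (fun y : R => y ^+ 2) 2^-1 x 1 _ h2)).
  by rewrite /GRing.scale/= mulrA mulVf ?mul1r// pnatr_eq0.
have h3 := @is_derive1_comp R expR (fun y : R => - (y ^+ 2 / 2)) x _ _ (is_derive_expR _) h.
have h4 := @is_deriveZ _ _ _ _ c x 1 _ h3.
apply: (is_derive_eq h4).
rewrite /GRing.scale/= /Gf; ring.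
Qed.

Let dxG (x : R) : is_derive x 1 (fun y => y * Gf y) ((1 - x ^+ 2) * Gf x).
Proof.
apply: (is_derive_eq (@is_deriveM _ _ id Gf x 1 _ _ (is_derive_id _ _) (dG x))).
rewrite /GRing.scale/=; ring.
Qed.

Let cG : continuous Gf.
Proof. by rewrite -gE; apply: continuous_normal_pdf; rewrite oner_neq0. Qed.

Let cpG (p : {poly R}) : continuous (fun x => p.[x] * Gf x).
Proof.
move=> x; apply: (@continuousM R R (horner p) Gf x); last exact: cG.
exact: (@continuous_horner R p x).
Qed.

(** The bound exp y >= y at y = x^2 / 2 gives x [Gf] x <= 2 c / x. *)
Let xG_cvg0 : (fun x => x * Gf x) x @[x --> +oo] --> 0.
Proof.
apply/cvgrPdist_le => /= e e0; near=> x.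
have x0 : 0 < x by near: x; apply: nbhs_pinfty_gt; rewrite ?num_real.
have xe : c * 2 / e <= x by near: x; apply: nbhs_pinfty_ge; rewrite ?num_real.
rewrite sub0r normrN ger0_norm; last first.
  by rewrite !mulr_ge0 ?(ltW x0) ?expR_ge0.
rewrite /Gf expRN.
have h : x ^+ 2 / 2 <= expR (x ^+ 2 / 2).
  by apply: le_trans (expR_ge1Dx _); rewrite lerDr.
have y0 : 0 < x ^+ 2 / 2 by rewrite divr_gt0// exprn_gt0.
apply: (@le_trans _ _ (x * (c * (x ^+ 2 / 2)^-1))).
  by rewrite !ler_wpM2l ?(ltW x0)// lef_pV2// posrE expR_gt0.
have -> : x * (c * (x ^+ 2 / 2)^-1) = (c * 2) / x by field; rewrite gt_eqF.
by rewrite ler_pdivrMr// -ler_pdivrMl// mulrC.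
Unshelve. all: by end_near. Qed.

Let mpG (p : {poly R}) D : measurable_fun D (fun x => (p.[x] * Gf x)%:E).
Proof.
by apply/measurable_EFinP/measurable_funTS; apply: continuous_measurable_fun; exact: cpG.
Qed.

Let mG D : measurable_fun D (fun x => (Gf x)%:E).
Proof.
by apply/measurable_EFinP/measurable_funTS; apply: continuous_measurable_fun; exact: cG.
Qed.

Let mx2G (D : set R) : measurable_fun D (fun x => (x ^+ 2 * Gf x)%:E).
Proof.
by have := @mpG ('X^2) D; apply: eq_measurable_fun => x _; rewrite !hornerE.
Qed.

Let G0 x : 0 <= Gf x. Proof. by rewrite mulr_ge0 ?expR_ge0. Qed.

(** The second moment comes from the primitive x [Gf] x of (1 - x^2) [Gf] x. The half-line is cut at
    1, where this derivative changes sign, so that the fundamental theorem on [[1, +oo[] is applied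
    to a nonnegative integrand. The boundary term [Gf 1] occurs in both parts, on opposite sides,
    and cancels. *)
Let tail_part : (\int[mu]_(x in `[1%R, +oo[) (x ^+ 2 * Gf x)%:E =
  \int[mu]_(x in `[1%R, +oo[) (Gf x)%:E + (Gf 1)%:E)%E.
Proof.
have h : (\int[mu]_(x in `[1%R, +oo[) ((x ^+ 2 - 1) * Gf x)%:E = 0%:E - (- Gf 1)%:E)%E.
  have := @ge0_continuous_FTC2y R (fun x => (x ^+ 2 - 1) * Gf x) (fun x => - (x * Gf x)) 1 0.
  rewrite mul1r; apply.
  - move=> x x1; rewrite mulr_ge0// subr_ge0 expr_ge1// (le_trans _ x1)//.
  - apply: continuous_subspaceT => x.
    have -> : (fun x : R => (x ^+ 2 - 1) * Gf x) = (fun x : R => ('X^2 - 1 : {poly R}).[x] * Gf x).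
      by apply/funext => y; rewrite !hornerE.
    exact: cpG.
  - by rewrite -oppr0; apply: cvgN; exact: xG_cvg0.
  - by move=> x _; apply: derivableN; have [] := dxG x.
  - rewrite -[X in _ --> - X]mul1r; apply: cvgN; apply: cvg_at_right_filter.
    by have := @cpG 'X 1; rewrite /continuous_at !hornerE; under eq_fun do rewrite hornerX.
  - move=> x _; have hx := dxG x.
    rewrite derive1E (_ : (fun x => - (x * Gf x)) = - (fun x => x * Gf x))// deriveN//.
    rewrite (@derive_val _ _ _ _ _ _ _ hx); ring.
rewrite -EFinB sub0r opprK in h; rewrite -h -ge0_integralD//.
- by apply: eq_integral => x _; rewrite -EFinD; congr EFin; ring.
- by move=> x _; rewrite lee_fin.
- exact: mG.
- move=> x; rewrite /= in_itv/= andbT => x1.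
  by rewrite lee_fin mulr_ge0// subr_ge0 expr_ge1// (le_trans _ x1).
- by have := @mpG ('X^2 - 1) `[1, +oo[; apply: eq_measurable_fun => x _; rewrite !hornerE.
Qed.

Let head_part : (\int[mu]_(x in `[0%R, 1%R]) (Gf x)%:E =
  \int[mu]_(x in `[0%R, 1%R]) (x ^+ 2 * Gf x)%:E + (Gf 1)%:E)%E.
Proof.
have h : (\int[mu]_(x in `[0%R, 1%R]) ((1 - x ^+ 2) * Gf x)%:E = (Gf 1)%:E - 0%:E)%E.
  have := @continuous_FTC2 R (fun x => (1 - x ^+ 2) * Gf x) (fun x => (x * Gf x)) 0 1.
  rewrite mul1r mul0r; apply => //.
  - apply: continuous_subspaceT => x.
    have -> : (fun x : R => (1 - x ^+ 2) * Gf x) = (fun x : R => (1 - 'X^2 : {poly R}).[x] * Gf x).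
      by apply/funext => y; rewrite !hornerE.
    exact: cpG.
  - have cF : continuous (fun x : R => x * Gf x).
      have -> : (fun x : R => x * Gf x) = (fun x : R => ('X : {poly R}).[x] * Gf x).
        by apply/funext => y; rewrite !hornerE.
      exact: cpG.
    split.
    + by move=> x _; have [] := dxG x.
    + by apply: cvg_at_right_filter; exact: cF.
    + by apply: cvg_at_left_filter; exact: cF.
  - move=> x _; have hx := dxG x.
    by rewrite derive1E (@derive_val _ _ _ _ _ _ _ hx).
rewrite sube0 in h; rewrite -h -ge0_integralD//.
- by apply: eq_integral => x _; rewrite -EFinD; congr EFin; ring.
- by move=> x _; rewrite lee_fin mulr_ge0// sqr_ge0.
- exact: mx2G.
- move=> x; rewrite /= in_itv/= => /andP[x0 x1].
  by rewrite lee_fin mulr_ge0// subr_ge0 -[leRHS](expr1n _ 2) ler_pXn2r ?nnegrE.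
- by have := @mpG (1 - 'X^2) `[0, 1]; apply: eq_measurable_fun => x _; rewrite !hornerE.
Qed.

Lemma integral_normal2 : (\int[N01]_x (x ^+ 2)%:E = 1)%E.
Proof.
rewrite ge0_integral_normal//; last 2 first.
- by apply/measurable_EFinP; exact: measurable_funX.
- by move=> x; rewrite lee_fin sqr_ge0.
rewrite -(@integral_normal_pdf R 0 1) gE.
under eq_integral do rewrite -EFinM.
rewrite ge0_symfun_integralT; last 3 first.
- by move=> x; rewrite mulr_ge0// sqr_ge0.
- move=> x; have -> : (fun x : R => x ^+ 2 * Gf x) = (fun x : R => ('X^2 : {poly R}).[x] * Gf x).
      by apply/funext => y; rewrite !hornerE.
  exact: cpG.
- by move=> x; rewrite /= /Gf sqrrN.
rewrite [RHS]ge0_symfun_integralT//; last by move=> x; rewrite /= /Gf sqrrN.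
congr (_ * _)%E; rewrite -set_itvcy.
have U : `[0%R, +oo[%classic = `[0%R, 1%R[ `|` `[1%R, +oo[ :> set R.
  by rewrite (@itv_bndbnd_setU _ _ _ (BLeft 1))// bnd_simp.
have dj : [disjoint `[0%R, 1%R[ & `[1%R, +oo[ : set R].
  apply/disj_setPS => x/= []; rewrite !in_itv/= andbT => /andP[_ x1].
  by rewrite leNgt x1.
have split_int (f : R -> R) : (forall x, 0 <= f x) -> measurable_fun setT (fun x => (f x)%:E) ->
    (\int[mu]_(x in `[0%R, +oo[) (f x)%:E =
     \int[mu]_(x in `[0%R, 1%R]) (f x)%:E + \int[mu]_(x in `[1%R, +oo[) (f x)%:E)%E.
  move=> f0 mf; rewrite U ge0_integral_setU//; last 2 first.
  - exact: measurable_funTS.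
  - by move=> x _; rewrite lee_fin.
  by rewrite integral_itv_bndo_bndc//; exact: measurable_funTS.
rewrite !split_int//; last first.
  by move=> x; rewrite mulr_ge0// sqr_ge0.
by rewrite head_part tail_part addeCA addeC -addeA addeC.
Qed.

Lemma integrable_normal_id : N01.-integrable setT (fun x : R => x%:E).
Proof.
apply/integrableP; split; first exact/measurable_EFinP.
apply: le_lt_trans integral_normal_1Dx4_lty.
apply: ge0_le_integral => //.
- by apply: measurableT_comp => //; exact/measurable_EFinP.
- by apply/measurable_EFinP; apply: measurable_funD => //; exact: measurable_funX.
- move=> x _; rewrite abse_EFin lee_fin ler_norml.
  have := sqr_ge0 (x ^+ 2 - 1 / 2); have := sqr_ge0 (x + 1 / 2).
  have := sqr_ge0 (x - 1 / 2).
  by move=> ? ? ?; apply/andP; split; nra.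
Qed.

Lemma integrable_normal_sq : N01.-integrable setT (fun x : R => (x ^+ 2)%:E).
Proof.
apply/integrableP; split; first by apply/measurable_EFinP; exact: measurable_funX.
under eq_integral do rewrite abse_EFin ger0_norm ?sqr_ge0//.
by rewrite integral_normal2 ltry.
Qed.

End gaussian_moments.

(** * Linear and quadratic forms in the errors *)

Section orthogonal_sums.
Context d (T : measurableType d) (R : realType) (P : probability T R).

Lemma integral_sum_sq (I : finType) (p : pred I) (Z : I -> T -> R) :
  (forall i j, p i -> p j -> P.-integrable setT (fun w => (Z i w * Z j w)%:E)) ->
  (forall i j, p i -> p j -> i != j -> \int[P]_w (Z i w * Z j w)%:E = 0)%E ->
  (\int[P]_w ((\sum_(i | p i) Z i w) ^+ 2)%:E = \sum_(i | p i) \int[P]_w (Z i w ^+ 2)%:E)%E.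
Proof.
move=> iZ oZ.
(* Integrability is known only on [p]; cutting the products off by 0 elsewhere makes it hold for all
   indices before sum and integral are exchanged. *)
have iZ' i j : P.-integrable setT (fun w => if p i && p j then (Z i w * Z j w)%:E else 0%E).
  case: (boolP (p i && p j)) => [/andP[hi hj]|_]; first exact: iZ.
  exact: integrable0.
transitivity (\int[P]_w \sum_(i | p i) \sum_(j | p j)
    (if p i && p j then (Z i w * Z j w)%:E else 0%E))%E.
  apply: eq_integral => w _; rewrite expr2 mulr_suml -sumEFin.
  apply: eq_bigr => i hi; rewrite mulr_sumr -sumEFin.
  by apply: eq_bigr => j hj; rewrite hi hj.
rewrite integral_sum//; last by move=> i; apply: integrable_sum => // j _.
apply: eq_bigr => i hi.
rewrite integral_sum// (bigD1 i)//= big1 ?adde0; last first.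
  by move=> j /andP[hj ji]; rewrite hi hj; apply: oZ => //; rewrite eq_sym.
by apply: eq_integral => w _; rewrite hi.
Qed.

Variables (X : nat -> T -> R -> R) (eps : nat -> {RV P >-> R}) (n : nat).
Hypothesis XE : flm_design X eps.

Notation SX := (g_sigma_algebraType (sample_events X n)).
Notation SR j := (g_sigma_algebraType (rest_events X eps n j)).
Notation N01 := (@normal_prob R 0 1).

Lemma sample_events_measurable : sample_events X n `<=` measurable.
Proof. by move=> A [i _]; exact: (coord_events_measurable XE). Qed.

(** All the processes, [X j] included, belong to the rest; only the error of index [j] is removed.
    Coefficients built from the sample are therefore independent of [eps j]. *)
Lemma sample_sub_rest j : sample_events X n `<=` <<s rest_events X eps n j >>.
Proof.
move=> A [i /= ilt hA]; apply: sub_sigma_algebra.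
apply: (rest_eventsW ilt); case: eqP => [<-|_].
  exact: sub_sigma_algebra.
by apply: sub_sigma_algebra; left.
Qed.

Lemma measurable_fun_rest j (f : T -> R) :
  measurable_fun setT (f : SX -> R) -> measurable_fun setT (f : SR j -> R).
Proof. by apply: measurable_fun_sub_gen; exact: sample_sub_rest. Qed.

Lemma measurable_fun_sample (f : T -> R) :
  measurable_fun setT (f : SX -> R) -> measurable_fun setT f.
Proof. by apply: measurable_fun_gen; exact: sample_events_measurable. Qed.

Lemma measurable_eps_rest j l : (l < n)%N -> l != j ->
  measurable_fun setT (eps l : SR j -> R).
Proof.
move=> ln lj _ B mB; apply: sub_sigma_algebra; apply: (rest_eventsW ln).
rewrite (negPf lj); apply: sub_sigma_algebra; right.
by exists B.
Qed.

(* [distribution] lives on the Borel structure of [R] and [normal_prob] on that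
   of [measurableTypeR R]: the same sigma-algebra under two displays. *)
Lemma ge0_integral_eps i (h : R -> \bar R) :
  measurable_fun setT h -> (forall x, 0 <= h x)%E ->
  (\int[distribution P (eps i)]_x h x = \int[N01]_x h x)%E.
Proof.
move=> mh h0; have [_ _ _ _ /(_ i)[_ hd]] := XE.
rewrite ge0_integral_distribution//.
have me : measurable_fun setT (eps i : T -> measurableTypeR R).
  by move=> _ A mA; rewrite setTI; exact: measurable_funPTI.
pose e' : {mfun T >-> measurableTypeR R} :=
  HB.pack (eps i : T -> measurableTypeR R) (isMeasurableFun.Build _ _ _ _ _ me).
rewrite -(@ge0_integral_distribution _ _ T (measurableTypeR R) R P e')//.
by apply: eq_measure_integral => A mA _; exact: hd.
Qed.

Lemma integral_eps i (h : R -> \bar R) : measurable_fun setT h ->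
  (\int[distribution P (eps i)]_x h x = \int[N01]_x h x)%E.
Proof.
move=> mh; rewrite integralE [RHS]integralE; congr (_ - _)%E.
  by rewrite ge0_integral_eps//; exact: measurable_funepos.
by rewrite ge0_integral_eps//; exact: measurable_funeneg.
Qed.

Lemma integrable_eps i (h : R -> \bar R) :
  N01.-integrable setT h -> (distribution P (eps i)).-integrable setT h.
Proof.
move=> /integrableP[mh fh]; apply/integrableP; split => //.
by rewrite integral_eps//; exact: measurableT_comp.
Qed.

(* One integrable dominating function for all monomials of degree at most 4 in
   the errors. *)
Definition envelope (w : T) : R := Num.sqrt (Num.sqrt (1 + \sum_(i < n) eps i w ^+ 4)).

Let envelope4E w : envelope w ^+ 4 = 1 + \sum_(i < n) eps i w ^+ 4.
Proof.
have h : 0 <= 1 + \sum_(i < n) eps i w ^+ 4.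
  by rewrite addr_ge0// sumr_ge0// => i _; rewrite exprn_even_ge0.
by rewrite /envelope (exprM _ 2 2) !sqr_sqrtr.
Qed.

Lemma envelope_ge1 w : 1 <= envelope w.
Proof.
rewrite -(@ler_pXn2r _ 4) ?nnegrE ?sqrtr_ge0// envelope4E expr1n lerDl sumr_ge0// => i _.
by rewrite exprn_even_ge0.
Qed.

Lemma eps_le_envelope (i : 'I_n) w : `|eps i w| <= envelope w.
Proof.
rewrite -(@ler_pXn2r _ 4) ?nnegrE ?sqrtr_ge0// envelope4E.
rewrite -normrX ger0_norm ?exprn_even_ge0// (bigD1 i)//= addrCA lerDl.
by rewrite addr_ge0// sumr_ge0// => j _; rewrite exprn_even_ge0.
Qed.

Lemma integrable_envelope4 : P.-integrable setT (fun w => (envelope w ^+ 4)%:E).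
Proof.
apply: (@eq_integrable _ _ _ _ _ measurableT
   (fun w => 1 + \sum_(i < n) (eps i w ^+ 4)%:E)%E).
  by move=> w _; rewrite envelope4E EFinD -sumEFin.
apply: integrableD => //.
  apply/integrableP; split => //.
  under eq_integral do rewrite abse1.
  by rewrite integral_cst// mul1e (le_lt_trans (probability_le1 _ _)) ?ltry.
apply: integrable_sum => // i _.
have m4 : measurable_fun setT (fun x : R => x ^+ 4) by exact: measurable_funX.
apply/integrableP; split.
  by apply/measurable_EFinP; exact: measurable_funX.
under eq_integral do rewrite abse_EFin ger0_norm ?exprn_even_ge0//.
have /= <- := @ge0_integral_distribution _ _ T R R P (eps i) (fun x => (x ^+ 4)%:E).
- by rewrite integral_eps ?integral_normal_lty4//; exact/measurable_EFinP.
- exact/measurable_EFinP.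
- by move=> x; rewrite lee_fin exprn_even_ge0.
Qed.

Lemma integrable_le_envelope (f : T -> R) (K : R) :
  measurable_fun setT f -> (forall w, `|f w| <= K * envelope w ^+ 4) ->
  P.-integrable setT (fun w => (f w)%:E).
Proof.
move=> mf fK.
apply: (@le_integrable _ _ _ _ _ measurableT _ (fun w => K%:E * (envelope w ^+ 4)%:E)%E).
- exact/measurable_EFinP.
- move=> w _ /=; rewrite lee_fin; apply: le_trans (fK w) _.
  by rewrite ler_norm.
- exact: integrableZl integrable_envelope4.
Qed.

(** For cross terms: [H] collects the random coefficients and every error other than [eps j]. *)
Lemma integral_restM_eq0 (j : 'I_n) (H : T -> R) (h : R -> R) (K : R) :
  measurable_fun setT (H : SR j -> R) -> (forall w, `|H w| <= K * envelope w ^+ 4) ->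
  measurable_fun setT h -> N01.-integrable setT (fun x => (h x)%:E) ->
  (\int[N01]_x (h x)%:E = 0)%E ->
  P.-integrable setT (fun w => (H w * h (eps j w))%:E) /\
  (\int[P]_w (H w * h (eps j w))%:E = 0)%E.
Proof.
move=> mH HK mh ih h0.
have GM : rest_events X eps n j `<=` measurable by exact: (rest_events_measurable XE).
apply: (@integral_indepM_eq0 _ _ _ P (rest_events X eps n j) (eps j)) => //.
- exact: (rest_indep XE).
- by apply: (@integrable_le_envelope _ K) => //; exact: measurable_fun_gen mH.
- exact: integrable_eps.
- by rewrite integral_eps//; exact/measurable_EFinP.
Qed.

Lemma ge0_integral_restM (j : 'I_n) (H : T -> R) (h : R -> R) :
  measurable_fun setT (H : SR j -> R) -> measurable_fun setT h ->
  (forall w, 0 <= H w) -> (forall x, 0 <= h x) ->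
  (\int[P]_w (H w * h (eps j w))%:E = \int[P]_w (H w)%:E * \int[N01]_x (h x)%:E)%E.
Proof.
move=> mH mh H0 h0.
rewrite -(integral_eps j); last exact/measurable_EFinP.
rewrite (@ge0_integral_indepM _ _ _ P (rest_events X eps n j) (eps j))//.
- exact: (rest_events_measurable XE).
- exact: (rest_indep XE).
Qed.

Variable K : R.
Hypothesis K0 : 0 <= K.

(** Used twice: with [h] the identity for the linear form, and with h(x) = x^2 - 1 for the diagonal
    of the quadratic form. The growth condition puts products of two values of [h] under the
    envelope. *)
Lemma integral_linear_sq (a : 'I_n -> T -> R) (h : R -> R) (L : R) :
  (forall i, measurable_fun setT (a i : SX -> R)) ->
  (forall i w, `|a i w| <= K) ->
  measurable_fun setT h -> 0 <= L -> (forall x, h x ^+ 2 <= L * (1 + x ^+ 4)) ->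
  N01.-integrable setT (fun x => (h x)%:E) ->
  (\int[N01]_x (h x)%:E = 0)%E ->
  (\int[P]_w ((\sum_i a i w * h (eps i w)) ^+ 2)%:E =
   (\sum_i \int[P]_w (a i w ^+ 2)%:E) * \int[N01]_x (h x ^+ 2)%:E)%E.
Proof.
move=> ma aK mh L0 hL ih h0.
have mT i : measurable_fun setT (a i) by exact: measurable_fun_sample.
have mhe i : measurable_fun setT (fun w => h (eps i w)) by exact: measurableT_comp.
have hM (i : 'I_n) w : h (eps i w) ^+ 2 <= L * (2 * envelope w ^+ 4).
  apply: (le_trans (hL _)); rewrite ler_wpM2l// [2 * _]mulrDl !mul1r lerD//.
    by rewrite exprn_ege1// envelope_ge1.
  rewrite -[leLHS]ger0_norm ?exprn_even_ge0// normrX.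
  by rewrite lerXn2r ?nnegrE ?sqrtr_ge0// eps_le_envelope.
have hMM (i j : 'I_n) w : `|h (eps i w) * h (eps j w)| <= L * (2 * envelope w ^+ 4).
  have h1 := hM i w; have h2 := hM j w.
  rewrite ler_norml; apply/andP; split; nra.
rewrite integral_sum_sq.
- rewrite ge0_sume_distrl; last first.
    by move=> i _; apply: integral_ge0 => w _; rewrite lee_fin sqr_ge0.
  apply: eq_bigr => i _.
  under eq_integral do rewrite exprMn.
  rewrite (@ge0_integral_restM i (fun w => a i w ^+ 2) (fun x => h x ^+ 2))//.
  + by apply: measurable_funX; exact: measurable_fun_rest.
  + exact: measurable_funX.
  + by move=> w; rewrite sqr_ge0.
  + by move=> w; rewrite sqr_ge0.
- move=> i j _ _; apply: (@integrable_le_envelope _ (K * K * (L * 2))).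
    by apply: measurable_funM; apply: measurable_funM.
  move=> w; rewrite mulrACA normrM -[leRHS]mulrA -[_ * 2 * _]mulrA ler_pM// normrM ler_pM//.
- move=> i j _ _ ij.
  under eq_integral do rewrite mulrA.
  have K1 : 0 <= K * K * (L + 1) by rewrite !mulr_ge0// addr_ge0.
  (* The constant comes from |h| <= 1 + h^2, where 1 and h^2 are at most 1 and 2 L times the fourth
     power of the envelope. *)
  apply: (@integral_restM_eq0 j (fun w => a i w * h (eps i w) * a j w) h (K * K * (1 + L * 2)) _ _ _ _ _).2 => //.
    apply: measurable_funM; last exact: measurable_fun_rest.
    apply: measurable_funM; first exact: measurable_fun_rest.
    by apply: measurableT_comp => //; apply: measurable_eps_rest.
  move=> w; rewrite mulrAC normrM -[leRHS]mulrA ler_pM//; first by rewrite normrM ler_pM.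
  have := hM i w; have := exprn_ege1 4 (envelope_ge1 w).
  set e4 := envelope w ^+ 4; set y := h _ => e1 hy.
  have : `|y| <= 1 + y ^+ 2 by rewrite ler_norml; apply/andP; split; nra.
  nra.
Qed.

(** The conditions on [p] keep one orientation of each off-diagonal pair: the products for (i, l)
    and (l, i) are the same variable and would not be orthogonal. The squared terms are computed by
    integrating out the two errors one after the other. *)
Lemma integral_bilinear_sq (a : 'I_n * 'I_n -> T -> R) (p : pred ('I_n * 'I_n)) :
  (forall q, measurable_fun setT (a q : SX -> R)) ->
  (forall q w, `|a q w| <= K) ->
  (forall q, p q -> q.1 != q.2) -> (forall q, p q -> ~~ p (q.2, q.1)) ->
  (\int[P]_w ((\sum_(q | p q) a q w * (eps q.1 w * eps q.2 w)) ^+ 2)%:E =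
   \sum_(q | p q) \int[P]_w (a q w ^+ 2)%:E)%E.
Proof.
move=> ma aK pN psym.
have mT q : measurable_fun setT (a q) by exact: measurable_fun_sample.
have eE (i : 'I_n) w : `|eps i w| <= envelope w by exact: eps_le_envelope.
have e1 w : 1 <= envelope w by exact: envelope_ge1.
have e0 w : 0 <= envelope w by exact: le_trans (e1 w).
have KK : 0 <= K * K by rewrite mulr_ge0.
have vanish (j : 'I_n) q (i1 i2 i3 : 'I_n) : i1 != j -> i2 != j -> i3 != j ->
    forall q', (\int[P]_w (a q w * a q' w * (eps i1 w * eps i2 w * eps i3 w) * eps j w)%:E = 0)%E.
  move=> h1 h2 h3 q'.
  apply: (@integral_restM_eq0 j (fun w => a q w * a q' w * (eps i1 w * eps i2 w * eps i3 w)) id (K * K) _ _ _ _ _).2.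
  - apply: measurable_funM.
      by apply: measurable_funM; exact: measurable_fun_rest.
    apply: measurable_funM; last exact: measurable_eps_rest.
    by apply: measurable_funM; exact: measurable_eps_rest.
  - move=> w; rewrite normrM ler_pM//; first by rewrite normrM ler_pM.
    rewrite !normrM; apply: (@le_trans _ _ (envelope w * envelope w * envelope w)).
      by rewrite !ler_pM ?mulr_ge0.
    rewrite -[leLHS]mulr1 (_ : envelope w ^+ 4 = envelope w * envelope w * envelope w * envelope w); last by ring.
    by rewrite ler_pM ?mulr_ge0.
  - by [].
  - exact: integrable_normal_id.
  - exact: integral_normal1.
rewrite integral_sum_sq.
- apply: eq_bigr => q pq.
  have qq := pN q pq.
  under eq_integral do rewrite exprMn [(eps _ _ * _) ^+ 2]exprMn mulrA.
  rewrite (@ge0_integral_restM q.2 (fun w => a q w ^+ 2 * eps q.1 w ^+ 2) (fun x => x ^+ 2))//; first last.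
  + by move=> w; rewrite sqr_ge0.
  + by move=> w; rewrite mulr_ge0// sqr_ge0.
  + apply: measurable_funM; apply: measurable_funX; first exact: measurable_fun_rest.
    exact: measurable_eps_rest.
  rewrite integral_normal2 mule1.
  rewrite (@ge0_integral_restM q.1 (fun w => a q w ^+ 2) (fun x => x ^+ 2))//; first last.
  + by move=> w; rewrite sqr_ge0.
  + by move=> w; rewrite sqr_ge0.
  + by apply: measurable_funX; exact: measurable_fun_rest.
  by rewrite integral_normal2 mule1.
- move=> q q' pq pq'; apply: (@integrable_le_envelope _ (K * K)).
    by apply: measurable_funM; apply: measurable_funM => //; apply: measurable_funM.
  move=> w; rewrite mulrACA normrM ler_pM//; first by rewrite normrM ler_pM.
  rewrite !normrM (_ : envelope w ^+ 4 = envelope w * envelope w * (envelope w * envelope w)); last by ring.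
  by rewrite !ler_pM ?mulr_ge0.
- move=> [i l] [i' l'] pq pq' qq /=.
  have /= il := pN _ pq; have /= il' := pN _ pq'; have /= sq := psym _ pq.
  (* Two distinct unordered pairs: some index of the first is absent from the second, so its error
     occurs once in the product and is integrated out. *)
  have [h|h] : ((i != i') && (i != l')) \/ ((l != i') && (l != l')).
    have [ii|ii] := eqVneq i i'; have [li|li] := eqVneq l l'.
    + by move: qq; rewrite ii li eqxx.
    + by right; rewrite andbT eq_sym -ii.
    + by left; rewrite /= -li.
    + have [il2|il2] := eqVneq i l'; last by left.
      have [li2|li2] := eqVneq l i'; last by right.
      by move: sq; rewrite il2 li2 pq'.
  + have /andP[h1 h2] := h.
    under eq_integral => w _.
      rewrite (_ : _ * _ = a (i, l) w * a (i', l') w * (eps l w * eps i' w * eps l' w) * eps i w); last by ring.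
      over.
    by apply: vanish; rewrite // eq_sym.
  + have /andP[h1 h2] := h.
    under eq_integral => w _.
      rewrite (_ : _ * _ = a (i, l) w * a (i', l') w * (eps i w * eps i' w * eps l' w) * eps l w); last by ring.
      over.
    by apply: vanish; rewrite // eq_sym.
Qed.

End orthogonal_sums.

(** * Diagonal forms in rotated coordinates *)

Section orthogonal_matrices.
Context (R : realType) (n : nat) (U : 'M[R]_n).

Lemma sum_sq_mulmx (c : 'I_n -> R) : U^T *m U = 1%:M ->
  \sum_i (\sum_v c v * U i v) ^+ 2 = \sum_v c v ^+ 2.
Proof.
move=> UU; pose C : 'cV[R]_n := \col_v c v.
have E : ((U *m C)^T *m (U *m C)) 0 0 = \sum_v c v ^+ 2.
  rewrite trmx_mul -mulmxA (mulmxA U^T) UU mul1mx mxE.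
  by apply: eq_bigr => v _; rewrite !mxE expr2.
rewrite -E mxE; apply: eq_bigr => i _; rewrite !mxE -expr2; congr (_ ^+ 2).
by apply: eq_bigr => v _; rewrite !mxE mulrC.
Qed.

(** The entries of U diag(dd) U^T. *)
Definition quad_coef (dd : 'I_n -> R) (i l : 'I_n) : R := \sum_v dd v * U i v * U l v.

(** Orthogonal conjugation preserves the Frobenius norm; this makes the variance of the quadratic
    form free of the random [U]. *)
Lemma sum_sq_quad_coef (dd : 'I_n -> R) : U^T *m U = 1%:M ->
  \sum_i \sum_l quad_coef dd i l ^+ 2 = \sum_v dd v ^+ 2.
Proof.
move=> UU; pose D : 'M[R]_n := diag_mx (\row_v dd v).
have AE i l : (U *m D *m U^T) i l = quad_coef dd i l.
  rewrite mxE; apply: eq_bigr => v _; rewrite mul_mx_diag !mxE; ring.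
have : \tr ((U *m D *m U^T) *m (U *m D *m U^T)^T) = \sum_v dd v ^+ 2.
  rewrite !trmx_mul trmxK tr_diag_mx !mulmxA.
  rewrite -(mulmxA _ U^T U) UU mulmx1 mxtrace_mulC !mulmxA UU mul1mx.
  rewrite /mxtrace; apply: eq_bigr => v _.
  by rewrite mul_diag_mx !mxE eqxx mulr1n expr2.
move=> <-; apply: eq_bigr => i _; rewrite mxE; apply: eq_bigr => l _.
by rewrite [X in _ * X]mxE !AE expr2.
Qed.

Lemma sum_quad_coef_diag (dd : 'I_n -> R) : U^T *m U = 1%:M ->
  \sum_i quad_coef dd i i = \sum_v dd v.
Proof.
move=> UU; rewrite exchange_big/=; apply: eq_bigr => v _.
have := congr1 (fun M : 'M[R]_n => M v v) UU; rewrite !mxE eqxx mulr1n => h.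
rewrite -[RHS]mulr1 -h mulr_sumr; apply: eq_bigr => i _.
by rewrite mxE mulrA.
Qed.

Lemma orthogonal_entry_le1 i v : U^T *m U = 1%:M -> `|U i v| <= 1.
Proof.
move=> UU; have := congr1 (fun M : 'M[R]_n => M v v) UU; rewrite !mxE eqxx mulr1n => h.
rewrite -(@ler_pXn2r _ 2) ?nnegrE// expr1n -[leRHS]h (bigD1 i)//= mxE -expr2.
rewrite real_normK ?num_real// lerDl sumr_ge0// => l _.
by rewrite mxE -expr2 sqr_ge0.
Qed.

(** The subtracted constants add up to the trace, which equals the sum of the diagonal coefficients,
    so each diagonal square is centred separately. The off-diagonal part is cut into two triangles
    to meet the conditions of [integral_bilinear_sq]. *)
Lemma sum_sq_centered (dd e : 'I_n -> R) : U^T *m U = 1%:M ->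
  \sum_v dd v * ((\sum_i U i v * e i) ^+ 2 - 1) =
  \sum_i quad_coef dd i i * (e i ^+ 2 - 1) +
  \sum_(q : 'I_n * 'I_n | (q.2 < q.1)%N) quad_coef dd q.1 q.2 * (e q.1 * e q.2) +
  \sum_(q : 'I_n * 'I_n | (q.1 < q.2)%N) quad_coef dd q.1 q.2 * (e q.1 * e q.2).
Proof.
move=> UU.
have sum_split (F : ('I_n * 'I_n)%type -> R) : \sum_q F q = \sum_i F (i, i) +
    \sum_(q : 'I_n * 'I_n | (q.2 < q.1)%N) F q + \sum_(q : 'I_n * 'I_n | (q.1 < q.2)%N) F q.
  rewrite (bigID (fun q : 'I_n * 'I_n => q.1 == q.2))/= -addrA; congr (_ + _).
    transitivity (\sum_i \sum_l if i == l then F (i, l) else 0).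
      by rewrite pair_bigA /= big_mkcond; apply: eq_bigr => -[].
    apply: eq_bigr => i _; rewrite -big_mkcond (big_pred1 i)//.
  rewrite (bigID (fun q : 'I_n * 'I_n => (q.2 < q.1)%N))/=; congr (_ + _);
    apply: eq_bigl => -[i l] /=; rewrite -val_eqE/=; by case: ltngtP.
have -> : \sum_v dd v * ((\sum_i U i v * e i) ^+ 2 - 1) =
    \sum_(q : 'I_n * 'I_n) quad_coef dd q.1 q.2 * (e q.1 * e q.2) - \sum_i quad_coef dd i i.
  rewrite sum_quad_coef_diag//.
  under eq_bigr do rewrite mulrBr mulr1.
  rewrite sumrB; congr (_ - _).
  rewrite -(pair_bigA _ (fun i l => quad_coef dd i l * (e i * e l)))/=.
  under [RHS]eq_bigr => i _ do under eq_bigr => l _ do rewrite mulr_suml.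
  under [RHS]eq_bigr => i _ do rewrite exchange_big/=.
  rewrite exchange_big/=; apply: eq_bigr => v _.
  rewrite expr2 mulr_suml mulr_sumr; apply: eq_bigr => i _.
  rewrite mulr_sumr mulr_sumr; apply: eq_bigr => l _; ring.
rewrite sum_split/=.
under [X in _ = X + _ + _]eq_bigr do rewrite mulrBr mulr1 expr2.
rewrite sumrB; ring.
Qed.

End orthogonal_matrices.

(** * Chebyshev bounds for the noise *)

Section chaos_tails.
Context d (T : measurableType d) (R : realType) (P : probability T R).
Variables (X : nat -> T -> R -> R) (eps : nat -> {RV P >-> R}) (n : nat).
Hypothesis XE : flm_design X eps.

Notation SX := (g_sigma_algebraType (sample_events X n)).
Notation N01 := (@normal_prob R 0 1).

Lemma markov_ge0 (f : T -> R) (M s : R) : measurable_fun setT f ->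
  (forall w, 0 <= f w) -> (\int[P]_w (f w)%:E <= M%:E)%E -> 0 < s ->
  (P [set w | (s <= f w)%R] <= (M / s)%:E)%E.
Proof.
move=> mf f0 fM s0.
pose Y : {mfun T >-> R} := HB.pack f (isMeasurableFun.Build _ _ _ _ _ mf).
have h := @markov _ _ _ P Y id s s0 (@measurable_id _ _ _) (fun r r0 => r0) (fun x y _ _ xy => xy).
rewrite EFinM lee_pdivlMr// muleC.
apply: le_trans fM; apply: le_trans (le_trans h _); last first.
  rewrite unlock; rewrite le_eqVlt; apply/orP; left; apply/eqP.
  by apply: eq_integral => w _ /=; rewrite ger0_norm.
rewrite (_ : [set x | (s%:E <= `|(Y x)%:E|)%E] = [set w | s <= f w])//.
by apply/seteqP; split => w /=; rewrite lee_fin ger0_norm.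
Qed.

Lemma centered_sq_lty : (\int[N01]_x (((x ^+ 2 - 1) ^+ 2)%:E) < +oo)%E.
Proof.
apply: le_lt_trans (integral_normal_1Dx4_lty R).
apply: ge0_le_integral => //.
- by move=> x _; rewrite lee_fin sqr_ge0.
- apply/measurable_EFinP; apply: measurable_funX.
  by apply: measurable_funB => //; exact: measurable_funX.
- by apply/measurable_EFinP; apply: measurable_funD => //; exact: measurable_funX.
- by move=> x _; rewrite lee_fin; have := sqr_ge0 x; nra.
Qed.

(** The variance of a squared standard normal variable, left unevaluated: finiteness and
    nonnegativity suffice. *)
Definition centered_sq : R := fine (\int[N01]_x (((x ^+ 2 - 1) ^+ 2)%:E))%E.

Lemma centered_sqE : (\int[N01]_x (((x ^+ 2 - 1) ^+ 2)%:E) = centered_sq%:E)%E.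
Proof.
rewrite fineK// ge0_fin_numE ?centered_sq_lty// integral_ge0// => x _.
by rewrite lee_fin sqr_ge0.
Qed.

Lemma centered_sq_ge0 : 0 <= centered_sq.
Proof. by rewrite fine_ge0// integral_ge0// => x _; rewrite lee_fin sqr_ge0. Qed.

Lemma sum_integral_sq_le (I : finType) (p : pred I) (a : I -> T -> R) (M : R) :
  (forall i, measurable_fun setT (a i)) -> (forall w, \sum_(i | p i) a i w ^+ 2 <= M) ->
  (\sum_(i | p i) \int[P]_w (a i w ^+ 2)%:E <= M%:E)%E.
Proof.
move=> ma aM.
rewrite big_mkcond.
under eq_bigr => i _.
  rewrite (_ : (if _ then _ else _) = \int[P]_w (if p i then a i w ^+ 2 else 0)%:E)%E; last first.
    by case: (p i) => //; rewrite integral0.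
  over.
rewrite -ge0_integral_sum//; last 2 first.
- move=> i; apply/measurable_EFinP; case: (p i) => //; exact: measurable_funX.
- by move=> i w _; case: (p i) => //; rewrite lee_fin sqr_ge0.
apply: (@le_trans _ _ (\int[P]_w (cst M%:E w))%E).
  apply: ge0_le_integral => //.
  - move=> w _; apply: sume_ge0 => i _; case: (p i) => //; by rewrite lee_fin sqr_ge0.
  - apply: emeasurable_sum => i; apply/measurable_EFinP; case: (p i) => //; exact: measurable_funX.
  - by move=> w _; rewrite sumEFin lee_fin -big_mkcond.
by rewrite integral_cst// [X in (_ * X)%E]probability_setT mule1.
Qed.

Variable U : T -> 'M[R]_n.
Hypothesis mU : forall i v, measurable_fun setT ((fun w => U w i v) : SX -> R).
(** The value 0 is allowed so that the alternative can hold at every point, while the design is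
    orthogonal only almost surely. *)
Hypothesis hU : forall w, (U w)^T *m U w = 1%:M \/ U w = 0.

Definition score w (v : 'I_n) : R := \sum_i U w i v * eps i w.

Let U_le1 w i v : `|U w i v| <= 1.
Proof.
by have [/orthogonal_entry_le1->//|->] := hU w; rewrite mxE normr0.
Qed.

Lemma measurable_score v : measurable_fun setT (score ^~ v).
Proof.
apply: measurable_sum => i; apply: measurable_funM => //.
exact: (measurable_fun_sample XE).
Qed.

(** The coefficients of [eps] are the entries of [U c], whose norm is at most that of [c]. *)
Lemma integral_linear_score_le (c : 'I_n -> R) :
  (\int[P]_w ((\sum_v c v * score w v) ^+ 2)%:E <= (\sum_v c v ^+ 2)%:E)%E.
Proof.
pose a i w := \sum_v c v * U w i v.
have E w : \sum_v c v * score w v = \sum_i a i w * eps i w.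
  under eq_bigr do rewrite mulr_sumr.
  rewrite exchange_big/=; apply: eq_bigr => i _.
  by rewrite mulr_suml; apply: eq_bigr => v _; rewrite mulrA.
under eq_integral do rewrite E.
have ma i : measurable_fun setT (a i : SX -> R).
  by apply: measurable_sum => v; apply: measurable_funM.
rewrite (@integral_linear_sq _ _ _ _ _ _ _ XE (\sum_v `|c v|) _ a id 1)//.
- rewrite integral_normal2 mule1; apply: sum_integral_sq_le.
    by move=> i; exact: (measurable_fun_sample XE).
  move=> w; have [h|h] := hU w; first by rewrite sum_sq_mulmx.
  rewrite big1; first by rewrite sumr_ge0// => v _; rewrite sqr_ge0.
  by move=> i _; rewrite /a big1 ?expr0n// => v _; rewrite h mxE mulr0.
- exact: sumr_ge0.
- move=> i w; apply: le_trans (ler_norm_sum _ _ _) _; apply: ler_sum => v _.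
  by rewrite normrM ler_piMr.
- by move=> x; have := sqr_ge0 x; have := sqr_ge0 (x ^+ 2 - 1); rewrite mul1r => ? ?; nra.
- exact: integrable_normal_id.
- exact: integral_normal1.
Qed.

Lemma integral_score_sq_le (dd : 'I_n -> R) :
  (\int[P]_w (\sum_v dd v ^+ 2 * score w v ^+ 2)%:E <= (\sum_v dd v ^+ 2)%:E)%E.
Proof.
under eq_integral do rewrite -sumEFin.
have ms v : measurable_fun setT (score ^~ v) := measurable_score v.
rewrite ge0_integral_sum//; last 2 first.
- by move=> v; apply/measurable_EFinP; apply: measurable_funM => //; exact: measurable_funX.
- by move=> v w _; rewrite lee_fin mulr_ge0// sqr_ge0.
rewrite -sumEFin; apply: lee_sum => v _.
have := integral_linear_score_le (fun u => if u == v then dd v else 0).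
rewrite [in leRHS](bigD1 v)//= eqxx big1 ?addr0; last first.
  by move=> u /negPf->; rewrite expr0n.
under eq_integral => w _.
  rewrite (bigD1 v)//= eqxx big1 ?addr0; last first.
    by move=> u /negPf->; rewrite mul0r.
  rewrite exprMn; over.
by [].
Qed.

(** Where [U w] is orthogonal, this is the sum of dd_v (score_v^2 - 1), by [sum_sq_centered]. The
    expanded form is the one with orthogonal terms, and it vanishes where [U w = 0], whereas the
    compact one would equal minus the sum of the dd_v there. *)
Definition chaos (dd : 'I_n -> R) w : R :=
  \sum_i quad_coef (U w) dd i i * (eps i w ^+ 2 - 1) +
  \sum_(q : 'I_n * 'I_n | (q.2 < q.1)%N) quad_coef (U w) dd q.1 q.2 * (eps q.1 w * eps q.2 w) +
  \sum_(q : 'I_n * 'I_n | (q.1 < q.2)%N) quad_coef (U w) dd q.1 q.2 * (eps q.1 w * eps q.2 w).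

Let mquad dd i l : measurable_fun setT ((fun w => quad_coef (U w) dd i l) : SX -> R).
Proof.
by apply: measurable_sum => v; apply: measurable_funM => //; apply: measurable_funM.
Qed.

Let mquadT dd i l : measurable_fun setT (fun w => quad_coef (U w) dd i l).
Proof. exact: (measurable_fun_sample XE). Qed.

Let mchaos1 dd : measurable_fun setT
  (fun w => \sum_i quad_coef (U w) dd i i * (eps i w ^+ 2 - 1)).
Proof.
apply: measurable_sum => i; apply: measurable_funM => //.
by apply: measurable_funB => //; exact: measurable_funX.
Qed.

Let mchaos2 dd (p : pred ('I_n * 'I_n)) : measurable_fun setT
  (fun w => \sum_(q | p q) quad_coef (U w) dd q.1 q.2 * (eps q.1 w * eps q.2 w)).
Proof.
under eq_fun do rewrite big_mkcond.
apply: measurable_sum => q; case: (p q) => //.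
by apply: measurable_funM => //; apply: measurable_funM.
Qed.

Lemma measurable_chaos dd : measurable_fun setT (chaos dd).
Proof. by apply: measurable_funD => //; apply: measurable_funD. Qed.

(** The factor 3 comes from (x + y + z)^2 <= 3 (x^2 + y^2 + z^2); the diagonal contributes
    [centered_sq] and each triangle contributes 1. *)
Lemma integral_chaos_sq_le (dd : 'I_n -> R) :
  (\int[P]_w (chaos dd w ^+ 2)%:E <= (3 * (centered_sq + 2) * \sum_v dd v ^+ 2)%:E)%E.
Proof.
pose M := \sum_v dd v ^+ 2.
have M0 : 0 <= M by rewrite sumr_ge0// => v _; rewrite sqr_ge0.
pose K := \sum_v `|dd v|.
have K0 : 0 <= K by exact: sumr_ge0.
have quad_le w i l : `|quad_coef (U w) dd i l| <= K.
  apply: le_trans (ler_norm_sum _ _ _) _; apply: ler_sum => v _.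
  by rewrite -mulrA normrM ler_piMr// normrM mulr_ile1.
have sq_le w : \sum_i \sum_l quad_coef (U w) dd i l ^+ 2 <= M.
  have [h|h] := hU w; first by rewrite sum_sq_quad_coef.
  rewrite big1// => i _; rewrite big1// => l _.
  by rewrite /quad_coef big1 ?expr0n// => v _; rewrite h !mxE !mulr0.
have pairs_le (p : pred ('I_n * 'I_n)) w : \sum_(q | p q) quad_coef (U w) dd q.1 q.2 ^+ 2 <= M.
  apply: le_trans (sq_le w); rewrite pair_bigA/= big_mkcond; apply: ler_sum => q _.
  by case: (p q) => //; rewrite sqr_ge0.
have h1 : (\int[P]_w ((\sum_i quad_coef (U w) dd i i * (eps i w ^+ 2 - 1)) ^+ 2)%:E
    <= (centered_sq * M)%:E)%E.
  rewrite (@integral_linear_sq _ _ _ _ _ _ _ XE K K0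
    (fun i w => quad_coef (U w) dd i i) (fun x => x ^+ 2 - 1) 1)//.
  - rewrite centered_sqE [(centered_sq * _)%R]mulrC EFinM lee_wpmul2r ?lee_fin ?centered_sq_ge0//.
    apply: sum_integral_sq_le => // w; apply: le_trans (sq_le w); apply: ler_sum => i _.
    by rewrite (bigD1 i)//= lerDl sumr_ge0// => l _; rewrite sqr_ge0.
  - by apply: measurable_funB => //; exact: measurable_funX.
  - by move=> x; rewrite mul1r; have := sqr_ge0 x; nra.
  - have h := @integrableB _ _ _ N01 setT measurableT _ _ (@integrable_normal_sq R)
      (@finite_measure_integrable_cst _ _ _ N01 setT 1 measurableT).
    by apply: eq_integrable h => // x _; rewrite /= -EFinB.
  - under eq_integral do rewrite EFinB.
    rewrite integralB//; last 2 first.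
    + exact: integrable_normal_sq.
    + exact: finite_measure_integrable_cst.
    by rewrite integral_normal2 integral_cst// [X in (_ * X)%E]probability_setT mul1e subee.
have h2 : (\int[P]_w ((\sum_(q : 'I_n * 'I_n | (q.2 < q.1)%N) quad_coef (U w) dd q.1 q.2 * (eps q.1 w * eps q.2 w)) ^+ 2)%:E <= M%:E)%E.
  rewrite (@integral_bilinear_sq _ _ _ _ _ _ _ XE K K0 (fun q w => quad_coef (U w) dd q.1 q.2))//.
  - by apply: sum_integral_sq_le => // w; exact: pairs_le.
  - by move=> q; rewrite -val_eqE/=; case: ltngtP.
  - by move=> [i l] /=; case: ltngtP.
have h3 : (\int[P]_w ((\sum_(q : 'I_n * 'I_n | (q.1 < q.2)%N) quad_coef (U w) dd q.1 q.2 * (eps q.1 w * eps q.2 w)) ^+ 2)%:E <= M%:E)%E.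
  rewrite (@integral_bilinear_sq _ _ _ _ _ _ _ XE K K0 (fun q w => quad_coef (U w) dd q.1 q.2))//.
  - by apply: sum_integral_sq_le => // w; exact: pairs_le.
  - by move=> q; rewrite -val_eqE/=; case: ltngtP.
  - by move=> [i l] /=; case: ltngtP.
set q1 := fun w => _ in h1; set q2 := fun w => _ in h2; set q3 := fun w => _ in h3.
have m1 : measurable_fun setT q1 by apply/measurable_EFinP; apply: measurable_funX; exact: mchaos1.
have m2 : measurable_fun setT q2 by apply/measurable_EFinP; apply: measurable_funX; exact: mchaos2.
have m3 : measurable_fun setT q3 by apply/measurable_EFinP; apply: measurable_funX; exact: mchaos2.
have q10 w : (0 <= q1 w)%E by rewrite lee_fin sqr_ge0.
have q20 w : (0 <= q2 w)%E by rewrite lee_fin sqr_ge0.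
have q30 w : (0 <= q3 w)%E by rewrite lee_fin sqr_ge0.
apply: (@le_trans _ _ (\int[P]_w (3%:E * (q1 w + (q2 w + q3 w))))%E).
  apply: ge0_le_integral => //.
  - by move=> w _; rewrite lee_fin sqr_ge0.
  - by apply/measurable_EFinP; apply: measurable_funX; exact: measurable_chaos.
  - by apply: emeasurable_funM => //; apply: emeasurable_funD => //; exact: emeasurable_funD.
  - move=> w _; rewrite /q1 /q2 /q3 -!EFinD -EFinM lee_fin /chaos.
    set x := \sum_i _; set y := \sum_(q : 'I_n * 'I_n | (q.2 < q.1)%N) _; set z := \sum_(q : 'I_n * 'I_n | (q.1 < q.2)%N) _.
    have := sqr_ge0 (x - y); have := sqr_ge0 (x - z); have := sqr_ge0 (y - z).
    move=> ? ? ?; nra.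
rewrite ge0_integralZl//; last 2 first.
- by apply: emeasurable_funD => //; exact: emeasurable_funD.
- by move=> w _; rewrite !adde_ge0.
rewrite ge0_integralD//; last 2 first.
- by move=> w _; rewrite !adde_ge0.
- exact: emeasurable_funD.
rewrite ge0_integralD//.
rewrite -mulrA EFinM lee_wpmul2l// -/M mulrDl EFinD leeD// (_ : 2 * M = M + M) ?EFinD ?leeD//.
by rewrite mulr_natl mulr2n.
Qed.

(** Three applications of Markov's inequality, each at a threshold proportional to its bound on the
    mean. The bounds [C] and [D] therefore cancel from the probability, leaving 1/s, 1/s and 3
    ([centered_sq] + 2)/s. *)
Lemma chaos_tail (c dd : 'I_n -> R) (C D s : R) :
  0 < C -> 0 < D -> \sum_v c v ^+ 2 <= C -> \sum_v dd v ^+ 2 <= D -> 0 < s ->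
  exists2 A : set T, measurable A &
    (P A <= ((3 * (centered_sq + 2) + 2) / s)%:E)%E /\
    forall w, ~ A w -> [/\ (\sum_v c v * score w v) ^+ 2 < s * C,
      \sum_v dd v ^+ 2 * score w v ^+ 2 < s * D & chaos dd w ^+ 2 < s * D].
Proof.
move=> C0 D0 cC dD s0.
have ms v : measurable_fun setT (score ^~ v) := measurable_score v.
pose f1 w := (\sum_v c v * score w v) ^+ 2.
pose f2 w := \sum_v dd v ^+ 2 * score w v ^+ 2.
pose f3 w := chaos dd w ^+ 2.
have mf1 : measurable_fun setT f1.
  by apply: measurable_funX; apply: measurable_sum => v; apply: measurable_funM.
have mf2 : measurable_fun setT f2.
  by apply: measurable_sum => v; apply: measurable_funM => //; apply: measurable_funX.
have mf3 : measurable_fun setT f3 by apply: measurable_funX; exact: measurable_chaos.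
have mA f u : measurable_fun setT f -> measurable [set w : T | u <= f w :> R].
  move=> mf; rewrite -[X in measurable X]setTI.
  have -> : [set w | u <= f w] = f @^-1` `[u, +oo[%classic.
    by apply/seteqP; split => w /=; rewrite in_itv/= andbT.
  exact: mf.
have s3 : 0 <= 3 * (centered_sq + 2) by rewrite mulr_ge0// addr_ge0// centered_sq_ge0.
have b (f : T -> R) k M N : measurable_fun setT f -> (forall w, 0 <= f w) -> 0 <= k ->
    (\int[P]_w (f w)%:E <= (k * M)%:E)%E -> M <= N -> 0 < N -> (P [set w | (s * N <= f w)%R] <= (k / s)%:E)%E.
  move=> mf f0 k0 fM MN N0.
  apply: le_trans (@markov_ge0 f (k * N) (s * N) mf f0 _ _) _.
  - by apply: le_trans fM _; rewrite lee_fin ler_wpM2l.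
  - by rewrite mulr_gt0.
  - rewrite lee_fin (_ : k * N / (s * N) = k / s)//; field.
    by rewrite !gt_eqF.
exists ([set w | s * C <= f1 w] `|` ([set w | s * D <= f2 w] `|` [set w | s * D <= f3 w])).
  by apply: measurableU; [|apply: measurableU]; exact: mA.
split.
  apply: le_trans (measureU2 _ _ _) _; [exact: mA|by apply: measurableU; exact: mA|].
  rewrite (_ : (3 * (centered_sq + 2) + 2) / s = 1 / s + (1 / s + 3 * (centered_sq + 2) / s)); last first.
    by field; rewrite gt_eqF.
  rewrite EFinD leeD//.
    apply: (b f1 1 (\sum_v c v ^+ 2)) => //.
    - by move=> w; rewrite sqr_ge0.
    - by rewrite mul1r; exact: integral_linear_score_le.
  apply: le_trans (measureU2 _ _ _) _; [exact: mA|exact: mA|].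
  rewrite EFinD leeD//.
    apply: (b f2 1 (\sum_v dd v ^+ 2)) => //.
    - by move=> w; rewrite sumr_ge0// => v _; rewrite mulr_ge0// sqr_ge0.
    - by rewrite mul1r; exact: integral_score_sq_le.
  apply: (b f3 _ (\sum_v dd v ^+ 2)) => //.
    by move=> w; rewrite sqr_ge0.
  exact: integral_chaos_sq_le.
move=> w /= /not_orP[/negP h1 /not_orP[/negP h2 /negP h3]].
by split; rewrite ltNge.
Qed.

End chaos_tails.

(** * The penalized statistic *)

Section penalized_statistic.
Context (R : realType).

Lemma dpen_gt0 (c0 : R) n j v : 0 <= lambda_ c0 n j -> 0 < dpen c0 n j v.
Proof. by move=> l0; rewrite invr_gt0 ltr_wpDr// mulr_ge0// exprn_ge0. Qed.

Lemma dpen_le1 (c0 : R) n j v : 0 <= lambda_ c0 n j -> dpen c0 n j v <= 1.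
Proof.
move=> l0; have h : 0 <= lambda_ c0 n j * v%:R ^+ (2 * j) by rewrite mulr_ge0// exprn_ge0.
by rewrite invf_le1 ?lerDl// ltr_wpDr.
Qed.

Lemma lambda_ge0 (c0 : R) n j : 0 <= lambda_ c0 n j.
Proof. by rewrite !mulr_ge0 ?powR_ge0// exprM exprn_ge0// sqr_ge0. Qed.

(** The matrix to invert is diagonal, with entries n / d_v. *)
Lemma PLRT_sum (c0 : R) n j (Om : 'M[R]_n) (Y : 'cV[R]_n) : (0 < n)%N ->
  - (2 * n%:R * PLRT c0 j Om Y) =
  \sum_(v < n) dpen c0 n j v.+1 * (\sum_i Om i v * Y i 0) ^+ 2 / n%:R.
Proof.
move=> n0; have nR : (n%:R : R) != 0 by rewrite pnatr_eq0 -lt0n.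
pose lam := lambda_ c0 n j.
pose D : 'M[R]_n := diag_mx (\row_(v < n) (n%:R * (1 + lam * (v.+1)%:R ^+ (2 * j)))).
pose D' : 'M[R]_n := diag_mx (\row_(v < n) (dpen c0 n j v.+1 / n%:R)).
have DE : (n%:R)%:M + (n%:R * lam) *: Lambda_ R n j = D.
  apply/matrixP => i l; rewrite !mxE; case: eqVneq => _; rewrite ?mulr1n ?mulr0n; ring.
have DD : D *m D' = 1%:M.
  rewrite mulmx_diag; apply/matrixP => i l; rewrite !mxE.
  case: eqVneq => _; rewrite ?mulr1n ?mulr0n// /dpen -/lam; field.
  rewrite nR gt_eqF// ltr_wpDr// mulr_ge0 ?lambda_ge0// exprn_ge0//.
have invD : invmx D = D'.
  have [uD _] := mulmx1_unit DD.
  by rewrite -[RHS]mul1mx -(mulVmx uD) -mulmxA DD mulmx1.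
rewrite /PLRT DE invD mulNr mulrN opprK mulrA divff ?mul1r; last first.
  by rewrite mulf_neq0// pnatr_eq0.
have -> : Y^T *m Om *m D' *m Om^T *m Y = (Om^T *m Y)^T *m D' *m (Om^T *m Y).
  by rewrite trmx_mul trmxK !mulmxA.
rewrite mxE; apply: eq_bigr => v _.
rewrite mul_mx_diag mxE [(\row__ _) _ _]mxE [(Om^T *m Y)^T _ _]mxE.
have -> : (Om^T *m Y) v 0 = \sum_i Om i v * Y i 0.
  by rewrite mxE; apply: eq_bigr => i _; rewrite mxE.
ring.
Qed.

(** Lagrange's identity writes the gap as half a double sum of squares. *)
Lemma cauchy_schwarz_sum (I : finType) (a b : I -> R) :
  (\sum_i a i * b i) ^+ 2 <= (\sum_i a i ^+ 2) * (\sum_i b i ^+ 2).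
Proof.
rewrite -subr_ge0.
have -> : (\sum_i a i ^+ 2) * (\sum_i b i ^+ 2) - (\sum_i a i * b i) ^+ 2 =
    2^-1 * \sum_i \sum_j (a i * b j - a j * b i) ^+ 2.
  under [X in _ = _ * X]eq_bigr => i _.
    under eq_bigr => j _.
      rewrite (_ : _ ^+ 2 = a i ^+ 2 * b j ^+ 2 + a j ^+ 2 * b i ^+ 2 - 2 * (a i * b i) * (a j * b j)); last by ring.
      over.
    rewrite !big_split/= sumrN -!mulr_sumr -mulr_suml.
    over.
  rewrite !big_split/= sumrN -!mulr_suml -!mulr_sumr.
  by field.
by rewrite mulr_ge0// ?invr_ge0// !sumr_ge0// => i _; rewrite sumr_ge0// => j _; rewrite sqr_ge0.
Qed.

Lemma norm_le_sqrt (x y : R) : x ^+ 2 <= y -> `|x| <= Num.sqrt y.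
Proof. by move=> xy; rewrite -sqrtr_sqr ler_wsqrtr. Qed.

(** Each rotated response is m + r + eta with r the rotated tail, of norm at most 2. After dropping
    d r^2 >= 0, the products m eta and r m cost 2 sqrt(s S) and 4 sqrt S; the centred eta^2 and the
    product r eta cost sqrt(s D) and 4 sqrt(s D), whence the 5. *)
Lemma statistic_lower_bound n (U : 'M[R]_n) (m tail e dd : 'I_n -> R) (s D : R) :
  U^T *m U = 1%:M -> \sum_i tail i ^+ 2 <= 4 ->
  (forall v, 0 <= dd v <= 1) -> 0 <= s ->
  let eta v := \sum_i U i v * e i in
  let S := \sum_v dd v * m v ^+ 2 in
  (\sum_v (dd v * m v) * eta v) ^+ 2 <= s * S ->
  \sum_v dd v ^+ 2 * eta v ^+ 2 <= s * D ->
  (\sum_v dd v * (eta v ^+ 2 - 1)) ^+ 2 <= s * D ->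
  S - (2 * Num.sqrt s + 4) * Num.sqrt S - 5 * Num.sqrt (s * D) <=
  \sum_v dd v * ((\sum_i U i v * (\sum_u m u * U i u + tail i + e i)) ^+ 2 - 1).
Proof.
move=> UU tail4 d01 s0 eta S hL hV hQ.
pose r v := \sum_i U i v * tail i.
have UU' : U *m U^T = 1%:M by exact: mulmx1C.
have r4 : \sum_v r v ^+ 2 <= 4.
  apply: le_trans tail4.
  have := @sum_sq_mulmx R n U^T tail; rewrite trmxK => /(_ UU') <-.
  by apply: ler_sum => v _; rewrite le_eqVlt; apply/orP; left; apply/eqP; congr (_ ^+ 2);
    rewrite /r; apply: eq_bigr => i _; rewrite mxE mulrC.
have zE v : \sum_i U i v * (\sum_u m u * U i u + tail i + e i) = m v + r v + eta v.
  under eq_bigr do rewrite !mulrDr.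
  rewrite !big_split/=; congr (_ + _ + _).
  under eq_bigr do rewrite mulr_sumr.
  rewrite exchange_big/= (bigD1 v)//= [X in _ + X]big1 ?addr0.
    have := congr1 (fun M : 'M[R]_n => M v v) UU; rewrite !mxE eqxx mulr1n => h.
    rewrite -[RHS]mulr1 -h mulr_sumr; apply: eq_bigr => i _; rewrite mxE; ring.
  move=> u uv; have := congr1 (fun M : 'M[R]_n => M v u) UU.
  rewrite !mxE eq_sym (negPf uv) mulr0n => h.
  transitivity (m u * \sum_j U^T v j * U j u); last by rewrite h mulr0.
  rewrite mulr_sumr; apply: eq_bigr => i _; rewrite mxE; ring.
under [leRHS]eq_bigr do rewrite zE.
have S0 : 0 <= S.
  by rewrite sumr_ge0// => v _; case/andP: (d01 v) => ? _; rewrite mulr_ge0// sqr_ge0.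
have h1 : `|\sum_v (dd v * m v) * eta v| <= Num.sqrt s * Num.sqrt S.
  by rewrite -sqrtrM// norm_le_sqrt.
have h2 := norm_le_sqrt hQ.
have four : (4 : R) = 2 ^+ 2 by rewrite -natrX.
have h3 : `|\sum_v r v * (dd v * m v)| <= 2 * Num.sqrt S.
  have -> : 2 * Num.sqrt S = Num.sqrt (4 * S).
    by rewrite [RHS]sqrtrM// four sqrtr_sqr ger0_norm.
  apply: norm_le_sqrt; apply: le_trans (cauchy_schwarz_sum _ _) _.
  rewrite ler_pM//; try by rewrite sumr_ge0// => v _; rewrite sqr_ge0.
  apply: ler_sum => v _; rewrite exprMn ler_wpM2r ?sqr_ge0//.
  by case/andP: (d01 v) => ? ?; rewrite expr2 ler_piMr.
have h4 : `|\sum_v r v * (dd v * eta v)| <= 2 * Num.sqrt (s * D).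
  have -> : 2 * Num.sqrt (s * D) = Num.sqrt (4 * (s * D)).
    by rewrite [RHS]sqrtrM// four sqrtr_sqr ger0_norm.
  apply: norm_le_sqrt; apply: le_trans (cauchy_schwarz_sum _ _) _.
  rewrite ler_pM//; try by rewrite sumr_ge0// => v _; rewrite sqr_ge0.
  by under eq_bigr do rewrite exprMn.
have main : S + 2 * (\sum_v (dd v * m v) * eta v) + \sum_v dd v * (eta v ^+ 2 - 1) +
    2 * (\sum_v r v * (dd v * m v)) + 2 * (\sum_v r v * (dd v * eta v)) <=
    \sum_v dd v * ((m v + r v + eta v) ^+ 2 - 1).
  rewrite !mulr_sumr -!big_split/=; apply: ler_sum => v _.
  have /andP[dv0 _] := d01 v.
  rewrite -subr_ge0 (_ : _ - _ = dd v * r v ^+ 2); last by ring.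
  by rewrite mulr_ge0// sqr_ge0.
apply: le_trans main.
move: h1 h2 h3 h4; rewrite !ler_norml => /andP[h1 _] /andP[h2 _] /andP[h3 _] /andP[h4 _].
rewrite mulrDl; lra.
Qed.

End penalized_statistic.

(** * The empirical covariance form and the tail of the slope *)

Section empirical_form.
Context (T : Type) (R : realType) (X : nat -> T -> R -> R) (n : nat) (w : T).
Notation mu := (@lebesgue_measure R).

Lemma integrable01_sum (I : finType) (F : I -> R -> R) :
  (forall i, integrable01 (F i)) -> integrable01 (fun t => \sum_i F i t).
Proof.
move=> iF; rewrite /integrable01 (_ : EFin \o _ = (fun t => \sum_i (F i t)%:E)%E).
  by apply: integrable_sum => // i _; exact: iF.
by apply/funext => t; rewrite /= -sumEFin.
Qed.

Lemma Rintegral_sum01 (I : finType) (F : I -> R -> R) :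
  (forall i, integrable01 (F i)) ->
  \int[mu]_(t in `[0, 1]) (\sum_i F i t) = \sum_i \int[mu]_(t in `[0, 1]) F i t.
Proof.
move=> iF; rewrite /Rintegral.
under eq_integral do rewrite -sumEFin.
rewrite integral_sum//.
by rewrite sum_fine// => i _; apply: integrable_fin_num => //; exact: iF.
Qed.

Lemma integrable01Zl (k : R) (f : R -> R) : integrable01 f -> integrable01 (fun t => k * f t).
Proof.
by move=> hf; rewrite /integrable01 (_ : EFin \o _ = (fun t => k%:E * (f t)%:E)%E)//; apply: integrableZl.
Qed.

(** The kernel is a finite sum of products, so the double integral separates. In this form [Vhat] is
    a Euclidean inner product, which is how both the orthonormality and the convergence of the slope
    series are used. *)
Lemma VhatE (f g : R -> R) :
  (forall i, (i < n)%N -> integrable01 (fun t => X i w t * f t)) ->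
  (forall i, (i < n)%N -> integrable01 (fun t => X i w t * g t)) ->
  Vhat X n w f g = n%:R^-1 * \sum_(i < n) inner01 (X i w) f * inner01 (X i w) g.
Proof.
move=> hf hg; rewrite /Vhat.
have innerE s : \int[mu]_(t in `[0, 1]) (Chat X n w s t * f s * g t) =
    \sum_(i < n) (n%:R^-1 * inner01 (X i w) g) * (X i w s * f s).
  transitivity (\int[mu]_(t in `[0, 1]) \sum_(i < n) (n%:R^-1 * (X i w s * f s)) * (X i w t * g t)).
    apply: eq_Rintegral => t _; rewrite /Chat mulr_sumr !mulr_suml.
    by apply: eq_bigr => i _; ring.
  rewrite (@Rintegral_sum01 _ (fun (i : 'I_n) t => (n%:R^-1 * (X i w s * f s)) * (X i w t * g t)))//.
    apply: eq_bigr => i _; rewrite RintegralZl//; last exact: hg.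
    by rewrite /inner01; ring.
  by move=> i; apply: integrable01Zl; exact: hg.
under eq_Rintegral do rewrite innerE.
rewrite (@Rintegral_sum01 _ (fun (i : 'I_n) s => (n%:R^-1 * inner01 (X i w) g) * (X i w s * f s)))//.
  rewrite mulr_sumr; apply: eq_bigr => i _; rewrite RintegralZl//; last exact: hf.
  by rewrite -/(inner01 _ _); ring.
by move=> i; apply: integrable01Zl; exact: hf.
Qed.

Lemma inner01_rest (phi : nat -> T -> R -> R) (b : nat -> R) (beta : R -> R) i m :
  (forall v, (1 <= v)%N -> integrable01 (fun t => X i w t * phi v w t)) ->
  integrable01 (fun t => X i w t * beta t) ->
  let rest t := beta t - \sum_(1 <= v < m.+1) b v * phi v w t in
  integrable01 (fun t => X i w t * rest t) /\
  inner01 (X i w) rest =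
  inner01 (X i w) beta - \sum_(1 <= v < m.+1) b v * inner01 (X i w) (phi v w).
Proof.
move=> hphi hbeta rest.
have E t : X i w t * rest t = X i w t * beta t - \sum_(v < m) b v.+1 * (X i w t * phi v.+1 w t).
  rewrite /rest mulrBr big_add1/= big_mkord mulr_sumr; congr (_ - _).
  by apply: eq_bigr => v _; ring.
have iv (v : 'I_m) : integrable01 (fun t => b v.+1 * (X i w t * phi v.+1 w t)).
  by apply: integrable01Zl; exact: hphi.
have is1 := integrable01_sum iv; have is2 := Rintegral_sum01 iv.
rewrite /inner01.
under [X in integrable01 X]eq_fun do rewrite E.
split.
  rewrite /integrable01 (_ : EFin \o _ = (fun t => (X i w t * beta t)%:E -
    (\sum_(v < m) b v.+1 * (X i w t * phi v.+1 w t))%:E)%E)//.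
  exact: integrableB.
under eq_Rintegral do rewrite E.
rewrite RintegralB// is2 big_add1/= big_mkord; congr (_ - _).
by apply: eq_bigr => v _; rewrite RintegralZl//; exact: hphi.
Qed.

(** Telescoping, from 1 / v^2 <= 1 / (v - 1) - 1 / v. *)
Lemma sum_inv_sq_le (a m : nat) : (0 < a)%N ->
  \sum_(a.+1 <= v < m) ((v%:R : R) ^+ 2)^-1 <= a%:R^-1.
Proof.
move=> a0; have [ma|am] := leqP m a; first by rewrite big_geq ?invr_ge0// leqW.
suff : \sum_(a.+1 <= v < m) ((v%:R : R) ^+ 2)^-1 <= a%:R^-1 - m.-1%:R^-1.
  by move/le_trans; apply; rewrite gerBl invr_ge0.
elim: m am => // m IHm; rewrite ltnS leq_eqVlt => /predU1P[<-|am].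
  by rewrite big_geq//= subrr.
rewrite big_nat_recr//=.
apply: le_trans (lerD (IHm am) (lexx _)) _.
have m0 : (0 < m)%N by exact: leq_ltn_trans am.
have p0 : (0 < m.-1)%N by rewrite -ltnS prednK// (leq_ltn_trans a0 am).
rewrite -addrA lerD2l -{2 3}(prednK m0) -subr_ge0.
have p0R : (0 : R) < m.-1%:R by rewrite ltr0n.
rewrite -natr1; set x := m.-1%:R in p0R *.
rewrite (_ : _ - _ = (x * (x + 1) ^+ 2)^-1); first by rewrite invr_ge0 mulr_ge0 ?sqr_ge0// ltW.
by field; rewrite !gt_eqF// ltr_wpDr.
Qed.

(** The tail is cut at some m >= n beyond which the remainder of the series has squared norm at most
    1. For n < v <= m, Cauchy-Schwarz pairs b_v v with omega_iv / v: the first factor is controlled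
    by the weighted norm as k >= 1, and summing the second over i gives at most n times the sum of 1
    / v^2 over v > n, hence at most 1. Then (x + y)^2 <= 2 x^2 + 2 y^2 gives 4. *)
Lemma tail_sq_le4 (phi : nat -> T -> R -> R) (b : nat -> R) (beta : R -> R) (k : nat) :
  (0 < n)%N -> (0 < k)%N ->
  (forall i v, (i < n)%N -> (1 <= v)%N -> integrable01 (fun t => X i w t * phi v w t)) ->
  (forall v, (n < v)%N -> Vhat X n w (phi v w) (phi v w) <= 1) ->
  (forall i, (i < n)%N -> integrable01 (fun t => X i w t * beta t)) ->
  (let rest m t := beta t - \sum_(1 <= v < m.+1) b v * phi v w t in
     (fun m => Vhat X n w (rest m) (rest m)) @ \oo --> (0 : R)) ->
  (forall m, \sum_(1 <= v < m) b v ^+ 2 * v%:R ^+ (2 * k) <= 1) ->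
  \sum_(i < n) (inner01 (X i w) beta -
    \sum_(1 <= v < n.+1) b v * inner01 (X i w) (phi v w)) ^+ 2 <= 4.
Proof.
move=> n0 k0 hphi hV hbeta hcvg hb.
have nR : (0 : R) < n%:R by rewrite ltr0n.
pose rest m t := beta t - \sum_(1 <= v < m.+1) b v * phi v w t.
have [m [nm hm]] : exists m, (n <= m)%N /\ Vhat X n w (rest m) (rest m) <= n%:R^-1.
  have /cvgrPdist_le/(_ n%:R^-1) := hcvg.
  rewrite invr_gt0 => /(_ nR)[m0 _ hm0]; exists (maxn n m0); split; first exact: leq_maxl.
  have := hm0 (maxn n m0) (leq_maxr _ _); rewrite sub0r normrN.
  exact: le_trans (ler_norm _).
have ir i : (i < n)%N -> integrable01 (fun t => X i w t * rest m t).
  by move=> ilt; exact: (@inner01_rest phi b beta i m (fun v => hphi i v ilt) (hbeta i ilt)).1.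
have hrest : \sum_(i < n) inner01 (X i w) (rest m) ^+ 2 <= 1.
  move: hm; rewrite VhatE// ler_pdivrMl// divff ?gt_eqF//; exact: le_trans.
have homega v : (n < v)%N -> \sum_(i < n) inner01 (X i w) (phi v w) ^+ 2 <= n%:R.
  move=> nv; have := hV v nv; rewrite VhatE//; last 2 first.
  - by move=> i ilt; apply: hphi => //; exact: leq_ltn_trans nv.
  - by move=> i ilt; apply: hphi => //; exact: leq_ltn_trans nv.
  by rewrite ler_pdivrMl// mulr1.
pose far i := \sum_(n.+1 <= v < m.+1) b v * inner01 (X i w) (phi v w).
have far_le (i : 'I_n) : far i ^+ 2 <= \sum_(n.+1 <= v < m.+1) inner01 (X i w) (phi v w) ^+ 2 / v%:R ^+ 2.
  have E (F : nat -> R) : \sum_(n.+1 <= v < m.+1) F v = \sum_(u < m - n) F (u + n.+1)%N.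
    by rewrite -{1}[n.+1]add0n big_addn subSS big_mkord.
  rewrite /far !E.
  rewrite (eq_bigr (fun u : 'I_(m - n) => (b (u + n.+1)%N * (u + n.+1)%:R) *
     (inner01 (X i w) (phi (u + n.+1)%N w) / (u + n.+1)%:R))); last first.
    by move=> u _; field; rewrite gt_eqF// ltr_wpDl// ltr_wpDr.
  apply: le_trans (cauchy_schwarz_sum _ _) _.
  rewrite [X in _ <= X](eq_bigr (fun u : 'I_(m - n) => (inner01 (X i w) (phi (u + n.+1)%N w) / (u + n.+1)%:R) ^+ 2)); last first.
    by move=> u _; rewrite exprMn exprVn.
  rewrite ler_piMl//; first by rewrite sumr_ge0// => u _; rewrite sqr_ge0.
  apply: le_trans (hb m.+1).
  rewrite (@big_cat_nat _ _ _ n.+1 1 m.+1)//= E.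
  apply: (@le_trans _ _ (\sum_(u < m - n) b (u + n.+1)%N ^+ 2 * (u + n.+1)%:R ^+ (2 * k))); last first.
    by rewrite lerDr sumr_ge0// => v _; rewrite mulr_ge0 ?sqr_ge0// exprn_ge0.
  apply: ler_sum => u _; rewrite exprMn ler_wpM2l ?sqr_ge0//.
  by rewrite ler_weXn2l ?leq_pmulr// ler1n addnS.
have hfar : \sum_(i < n) far i ^+ 2 <= 1.
  apply: le_trans (ler_sum _ (fun i _ => far_le i)) _.
  rewrite exchange_big/=.
  apply: (@le_trans _ _ (\sum_(n.+1 <= v < m.+1) n%:R * ((v%:R : R) ^+ 2)^-1)).
    rewrite big_nat_cond [leRHS]big_nat_cond; apply: ler_sum => v /andP[/andP[nv _] _].
    by rewrite -mulr_suml ler_wpM2r ?homega// invr_ge0 exprn_ge0.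
  by rewrite -mulr_sumr -ler_pdivlMl// mulr1; exact: sum_inv_sq_le.
have split_tail i : (i < n)%N -> inner01 (X i w) beta -
    \sum_(1 <= v < n.+1) b v * inner01 (X i w) (phi v w) = inner01 (X i w) (rest m) + far i.
  move=> ilt; rewrite (@inner01_rest phi b beta i m (fun v => hphi i v ilt) (hbeta i ilt)).2.
  rewrite (@big_cat_nat _ _ _ n.+1 1 m.+1)//= /far; ring.
apply: (@le_trans _ _ (\sum_(i < n) (2 * inner01 (X i w) (rest m) ^+ 2 + 2 * far i ^+ 2))).
  apply: ler_sum => i _; rewrite split_tail//.
  set x := inner01 _ _; set y := far i; have := sqr_ge0 (x - y); nra.
rewrite big_split/= -!mulr_sumr; lra.
Qed.

End empirical_form.

(** * Size of the signal under the alternatives *)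

Section alternatives.
Context (R : realType).
Implicit Types (b : nat -> R).

Lemma l2norm_wt_le1 k b m : (l2norm_wt k b <= 1)%E ->
  \sum_(1 <= v < m) b v ^+ 2 * v%:R ^+ (2 * k) <= 1.
Proof.
rewrite /l2norm_wt -[X in (_ <= X)%E]/((1 : R)%:E).
have -> : ((1 : R)%:E = sqrte (1%:E))%E by rewrite /= sqrtr1.
rewrite lee_sqrt// => h; rewrite -lee_fin -sumEFin; apply: le_trans h.
apply: nneseries_lim_ge => v _ _.
by rewrite lee_fin mulr_ge0 ?sqr_ge0// exprn_ge0.
Qed.

(** Termwise comparison with the weighted norm: damping loses 1 - d_v <= lambda v^(2k) for v <= n,
    and truncation loses 1 <= (v / n)^(2k) for v > n. *)
Lemma signal_lower_bound (c0 : R) n k b (t : R) : (0 < n)%N -> 0 <= t ->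
  (t%:E <= l2norm b)%E -> (l2norm_wt k b <= 1)%E ->
  t ^+ 2 <= \sum_(v < n) dpen c0 n k v.+1 * b v.+1 ^+ 2 +
            (lambda_ c0 n k + (n%:R ^+ (2 * k))^-1).
Proof.
move=> n0 t0 tb bk.
have l0 := lambda_ge0 c0 n k.
have s0 : (0 <= \sum_(1 <= v <oo) (b v ^+ 2)%:E)%E.
  by apply: nneseries_ge0 => v _ _; rewrite lee_fin sqr_ge0.
have : ((t ^+ 2)%:E <= \sum_(1 <= v <oo) (b v ^+ 2)%:E)%E.
  by rewrite -lee_sqrt// /= sqrtr_sqr ger0_norm.
rewrite -lee_fin => /le_trans; apply.
have cv : cvgn (fun m => \sum_(1 <= v < m) (b v ^+ 2)%:E)%E.
  by apply: is_cvg_ereal_nneg_natsum => v _; rewrite lee_fin sqr_ge0.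
apply: lime_le => //; exists n.+1 => // m /= nm.
rewrite sumEFin lee_fin.
have q0 : 0 <= lambda_ c0 n k + (n%:R ^+ (2 * k))^-1 by rewrite addr_ge0// invr_ge0 exprn_ge0.
rewrite -[X in _ + X]mulr1.
apply: le_trans; last by apply: lerD (lexx _) (ler_wpM2l q0 (l2norm_wt_le1 m bk)).
have n1 : (1 <= n.+1)%N by [].
have -> : \sum_(v < n) dpen c0 n k v.+1 * b v.+1 ^+ 2 =
    \sum_(1 <= v < n.+1) dpen c0 n k v * b v ^+ 2 by rewrite big_add1 big_mkord.
rewrite (@big_cat_nat _ _ _ n.+1 1 m)//= [X in _ <= _ + _ * X](@big_cat_nat _ _ _ n.+1 1 m)//=.
rewrite mulrDr addrA lerD//.
  rewrite mulr_sumr -big_split/=; apply: ler_sum => v _.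
  have d0 := @dpen_gt0 R c0 n k v l0.
  have w0 : 0 <= v%:R ^+ (2 * k) :> R by rewrite exprn_ge0.
  rewrite -subr_ge0.
  have -> : dpen c0 n k v * b v ^+ 2 + (lambda_ c0 n k + (n%:R ^+ (2 * k))^-1) *
      (b v ^+ 2 * v%:R ^+ (2 * k)) - b v ^+ 2 =
    b v ^+ 2 * ((dpen c0 n k v - 1 + lambda_ c0 n k * v%:R ^+ (2 * k)) +
      (n%:R ^+ (2 * k))^-1 * v%:R ^+ (2 * k)) by ring.
  apply: mulr_ge0; first exact: sqr_ge0.
  apply: addr_ge0; last by apply: mulr_ge0 => //; rewrite invr_ge0 exprn_ge0.
  rewrite /dpen; set y := lambda_ c0 n k * _.
  have y0 : 0 <= y by rewrite mulr_ge0.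
  rewrite (_ : _ - 1 + y = y ^+ 2 / (1 + y)); first by rewrite divr_ge0 ?sqr_ge0// addr_ge0.
  by field; rewrite gt_eqF// ltr_wpDr.
rewrite mulr_sumr big_nat_cond [leRHS]big_nat_cond; apply: ler_sum => v /andP[/andP[nv _] _].
rewrite -[leLHS]mulr1 mulrCA ler_wpM2l ?sqr_ge0//.
apply: (@le_trans _ _ ((n%:R ^+ (2 * k))^-1 * v%:R ^+ (2 * k))).
  have nn0 : (0 : R) < n%:R ^+ (2 * k) by rewrite exprn_gt0// ltr0n.
  by rewrite ler_pdivlMl// mulr1 lerXn2r ?nnegrE// ler_nat ltnW.
by rewrite ler_wpM2r ?exprn_ge0// lerDr.
Qed.

End alternatives.

(** * Measurability of the rejection event *)

Section measurability_of_rejection.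
Context d (T : measurableType d) (R : realType) (P : probability T R).
Variables (X : nat -> T -> R -> R) (eps : nat -> {RV P >-> R}) (n : nat).
Hypothesis XE : flm_design X eps.
Notation SX := (g_sigma_algebraType (sample_events X n)).

Lemma process_measurable_full (G : set (set T)) (Z : T -> R -> R) :
  G `<=` measurable -> process_measurable G Z ->
  measurable_fun ([set: T] `*` (`[0, 1]%classic : set R))
    (fun p : (T * R)%type => Z p.1 p.2).
Proof.
move=> GM mZ.
pose F (p : (g_sigma_algebraType G * R)%type) : R := Z p.1 p.2.
pose g (p : (T * R)%type) : (g_sigma_algebraType G * R)%type :=
  (p.1 : g_sigma_algebraType G, p.2).
apply: (@measurable_comp _ _ _ _ _ _ _ F _ g) mZ _.
- by apply: measurableX => //; exact: measurableT.
- by move=> _ [[w t] [_ t01] <-].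
- apply: measurable_funTS; apply: measurable_fun_pair => //.
  apply: (@measurableT_comp _ _ _ _ _ _ (idfun : T -> g_sigma_algebraType G)).
    by move=> _ A mA; rewrite setTI; exact: (sub_gen_measurable GM).
  exact: measurable_fst.
Qed.

Lemma measurable_Omega_entry (phi : nat -> T -> R -> R) (i v : nat) :
  (i < n)%N -> process_measurable (sample_events X n) (phi v) ->
  measurable_fun setT ((fun w => inner01 (X i w) (phi v w)) : SX -> R).
Proof.
move=> ilt mphi; apply: (@measurable_inner01 _ SX R (X i) (phi v)); last exact: mphi.
have [mX _ _ _ _] := XE.
apply: (@process_measurable_sub _ R (coord_events (X i))).
  by move=> A hA; apply: sub_sigma_algebra; exists i.
exact: mX.
Qed.

Lemma measurable_inner_slope (beta : T -> R -> R) (i : nat) :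
  measurable_fun ([set: T] `*` (`[0, 1]%classic : set R))
    (fun p : (T * R)%type => beta p.1 p.2 : R) ->
  measurable_fun setT (fun w => inner01 (X i w) (beta w)).
Proof.
move=> mb; apply: (@measurable_inner01 _ T R (X i) beta) => //.
have [mX _ _ _ _] := XE.
exact: (process_measurable_full (coord_events_measurable XE (i := i)) (mX i)).
Qed.

Lemma measurable_reject (phi : nat -> T -> R -> R) (beta : T -> R -> R)
    (c0 Bn alpha : R) (kn : nat) : (0 < n)%N ->
  (forall v, (1 <= v)%N -> process_measurable (sample_events X n) (phi v)) ->
  measurable_fun ([set: T] `*` (`[0, 1]%classic : set R))
    (fun p : (T * R)%type => beta p.1 p.2 : R) ->
  measurable (reject X eps n phi c0 kn Bn alpha beta).
Proof.
move=> n0 mphi mb.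
have mO (i v : 'I_n) : measurable_fun setT (fun w => Omega X n phi w i v).
  under eq_fun do rewrite mxE.
  apply: (measurable_fun_sample XE); apply: measurable_Omega_entry => //.
  exact: mphi.
have mY (i : 'I_n) : measurable_fun setT
    (fun w => responses X n eps beta w i 0).
  under eq_fun do rewrite mxE.
  by apply: measurable_funD => //; exact: measurable_inner_slope.
have mt j : measurable_fun setT
    (fun w => tau c0 j (Omega X n phi w) (responses X n eps beta w)).
  rewrite /tau; under eq_fun do rewrite PLRT_sum//.
  apply: measurable_funM => //; apply: measurable_funB => //.
  apply: measurable_sum => v; apply: measurable_funM => //; apply: measurable_funM => //.
  by apply: measurable_funX; apply: measurable_sum => i; exact: measurable_funM.
have mA : measurable_fun setT
    (fun w => ATstar c0 kn (Omega X n phi w) (responses X n eps beta w)).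
  rewrite /ATstar; elim: (index_iota _ _) => [|j s IH].
    by under eq_fun do rewrite big_nil; exact: mt.
  under eq_fun do rewrite big_cons.
  exact: measurable_maxr.
have mAT : measurable_fun setT
    (fun w => AT c0 kn Bn (Omega X n phi w) (responses X n eps beta w)).
  by apply: measurable_funM => //; exact: measurable_funB.
rewrite /reject -[X in measurable X]setTI.
set f := fun w => _ in mAT.
have -> : [set w | crit alpha < AT c0 kn Bn (Omega X n phi w) (responses X n eps beta w)] =
    f @^-1` `]crit alpha, +oo[%classic.
  by apply/seteqP; split => w /=; rewrite in_itv/= andbT.
exact: mAT.
Qed.

End measurability_of_rejection.

(** * Rates *)

Section rates.
Context (R : realType).

(** The sum is cut at m, just above 1 / h. Up to m each term is at most 1, for a total of at most 1
    / h + 1 <= 2 / h. Beyond m, h v >= 1 and k >= 1 give d_v^2 <= d_v <= (h v)^(-2), and these terms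
    add up to at most 1 / (h^2 m) <= 1 / h. *)
Lemma sum_dpen_sq_le (c0 h : R) n k : (0 < k)%N -> 0 < h -> h <= 1 ->
  lambda_ c0 n k = h ^+ (2 * k) ->
  \sum_(v < n) dpen c0 n k v.+1 ^+ 2 <= 3 / h.
Proof.
move=> k0 h0 h1 lh.
have l0 := lambda_ge0 c0 n k.
have dp v := @dpen_gt0 R c0 n k v l0.
have d1 v := @dpen_le1 R c0 n k v l0.
pose m := (Num.truncn h^-1).+1.
have hm : h^-1 <= m%:R by rewrite ltW// truncnS_gt.
have mh : m%:R <= h^-1 + 1.
  by rewrite -natr1 lerD2r truncn_le// invr_ge0 ltW.
have -> : \sum_(v < n) dpen c0 n k v.+1 ^+ 2 = \sum_(1 <= v < n.+1) dpen c0 n k v ^+ 2.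
  by rewrite big_add1 big_mkord.
have sq_le1 v : dpen c0 n k v ^+ 2 <= 1.
  by rewrite exprn_ile1// ltW.
have head (a : nat) : (a <= m)%N -> \sum_(1 <= v < a.+1) dpen c0 n k v ^+ 2 <= h^-1 + 1.
  move=> am; apply: le_trans mh.
  apply: (@le_trans _ _ (\sum_(1 <= v < a.+1) 1)); first exact: ler_sum.
  by rewrite sumr_const_nat subSS subn0 ler_nat.
have h10 : 1 <= h^-1 by rewrite invf_ge1.
have [nm|mn] := leqP n m.
  apply: le_trans (head n nm) _; rewrite -/(3 * h^-1); lra.
rewrite (@big_cat_nat _ _ _ m.+1 1 n.+1)//= ?ltnS 1?ltnW//.
have tail : \sum_(m.+1 <= v < n.+1) dpen c0 n k v ^+ 2 <= h^-1.
  apply: (@le_trans _ _ (\sum_(m.+1 <= v < n.+1) (h ^+ 2)^-1 * ((v%:R : R) ^+ 2)^-1)).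
    rewrite big_nat_cond [leRHS]big_nat_cond; apply: ler_sum => v /andP[/andP[mv _] _].
    apply: (@le_trans _ _ (dpen c0 n k v)).
      by rewrite expr2 ler_piMr// ltW.
    have v0 : (0 : R) < v%:R by rewrite ltr0n (leq_trans _ mv).
    rewrite -invfM -exprMn lef_pV2 ?posrE ?exprn_gt0 ?mulr_gt0//; last first.
      by rewrite ltr_wpDr// mulr_ge0// exprn_ge0.
    rewrite lh -exprMn; apply: (@le_trans _ _ ((h * v%:R) ^+ (2 * k))); last by rewrite lerDr.
    rewrite ler_weXn2l ?leq_pmulr//.
    by rewrite -ler_pdivrMl// mulr1 (le_trans hm)// ler_nat ltnW.
  rewrite -mulr_sumr.
  apply: (@le_trans _ _ ((h ^+ 2)^-1 * m%:R^-1)).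
    by rewrite ler_wpM2l ?invr_ge0 ?sqr_ge0//; exact: sum_inv_sq_le.
  have m0 : (0 : R) < m%:R by rewrite ltr0n.
  have mi : m%:R^-1 <= h by rewrite -[leRHS]invrK lef_pV2 ?posrE ?invr_gt0.
  have hh : (h ^+ 2)^-1 * h = h^-1 by field; rewrite gt_eqF.
  by rewrite -hh ler_wpM2l// invr_ge0 sqr_ge0.
have := head m (leqnn m) => hd.
apply: le_trans (lerD hd tail) _; rewrite -/(3 * h^-1); lra.
Qed.

Lemma natr_powR_root (x : R) (q p : nat) : 0 < x -> (0 < q)%N ->
  x `^ (p%:R / q%:R) = (x `^ (q%:R^-1)) ^+ p.
Proof.
by move=> x0 q0; rewrite mulrC powRrM powR_mulrn// powR_ge0.
Qed.

Lemma powR_root (x : R) (q : nat) : 0 < x -> (0 < q)%N -> (x `^ (q%:R^-1)) ^+ q = x.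
Proof.
move=> x0 q0; rewrite -natr_powR_root// divff ?powRr1 ?ltW//.
by rewrite pnatr_eq0 -lt0n.
Qed.

(* With [a = n^(1/(4k+1))] and [l = (log log n)^(1/(4k+1))], all rates are
   monomials: [delta = l^k / a^(2k)], [lambda_k = (c0 l / a^2)^(2k)] and
   [n delta^2 = a l^(2k)]. *)
Lemma rate_monomials (c0 : R) n k : 0 < c0 -> (0 < n)%N -> 1 <= ln (ln n%:R : R) ->
  c0 ^+ (4 * k + 1) <= n%:R ->
  exists a l : R, [/\ 1 <= a, 1 <= l & [/\ n%:R = a ^+ (4 * k + 1),
    ln (ln n%:R) = l ^+ (4 * k + 1), delta R n k = l ^+ k / a ^+ (2 * k),
    lambda_ c0 n k = (c0 * l / a ^+ 2) ^+ (2 * k) & c0 * l / a ^+ 2 <= 1]].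
Proof.
move=> c00 n0 L1 cn.
have q0 : (0 < 4 * k + 1)%N by rewrite addn1.
have nR : (0 : R) < n%:R by rewrite ltr0n.
have LR : (0 : R) < ln (ln n%:R) by exact: lt_le_trans L1.
pose a : R := n%:R `^ ((4 * k + 1)%:R^-1).
pose l : R := ln (ln n%:R) `^ ((4 * k + 1)%:R^-1).
have aE : a ^+ (4 * k + 1) = n%:R by exact: powR_root.
have lE : l ^+ (4 * k + 1) = ln (ln n%:R) by exact: powR_root.
have ge1 (x : R) : 0 <= x -> 1 <= x ^+ (4 * k + 1) -> 1 <= x.
  by move=> x0; rewrite -{1}(expr1n _ (4 * k + 1)) ler_pXn2r// ?nnegrE.
have a1 : 1 <= a by apply: ge1; rewrite ?powR_ge0// aE ler1n.
have l1 : 1 <= l by apply: ge1; rewrite ?powR_ge0// lE.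
have a0 : 0 < a by exact: lt_le_trans a1.
have l0 : 0 < l by exact: lt_le_trans l1.
exists a, l; split => //; split => //.
- rewrite /delta mulNr powRN natr_powR_root// natr_powR_root// mulrC//.
- rewrite /lambda_ mulNr powRN natr_powR_root// natr_powR_root// -/a -/l.
  rewrite !exprMn exprVn -exprM (_ : (2 * (2 * k) = 4 * k)%N) ?mulnA//; ring.
(* Raised to the power [4 * k + 1], the claim is c0^(4k+1) log log n <= n^2, and each factor on the
   left is at most n. *)
- rewrite ler_pdivrMr ?exprn_gt0// mul1r.
  rewrite -(@ler_pXn2r _ (4 * k + 1)) ?nnegrE ?mulr_ge0 ?exprn_ge0 ?(ltW a0) ?(ltW l0) ?(ltW c00)//.
  rewrite exprMn lE exprAC aE expr2 ler_pM ?exprn_ge0 ?(ltW LR) ?(ltW c00)//.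
  have n1 : 1 <= n%:R :> R by rewrite ler1n.
  have ln1 : 0 < ln (n%:R : R).
    rewrite ltNge; apply/negP => h; move: LR.
    by rewrite ltNge ln_le0// (le_trans h).
  by apply: le_trans (ltW (ln_sublinear ln1)) (ltW (ln_sublinear nR)).
Qed.

End rates.

(** * Size of the rejection threshold *)

Section thresholds.
Context (R : realType).

Lemma natr_eventually_ge (x : R) : exists N : nat, forall n, (N <= n)%N -> x <= n%:R.
Proof.
exists (Num.truncn x).+1 => n Nn.
by apply: le_trans (ltW (truncnS_gt x)) _; rewrite ler_nat.
Qed.

Lemma le_ln_eventually (x : R) : exists N : nat, forall n, (N <= n)%N -> (0 < n)%N /\ x <= ln (n%:R : R).
Proof.
have [N hN] := natr_eventually_ge (expR x); exists (maxn N 1) => n.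
rewrite geq_max => /andP[Nn n0]; split => //.
by rewrite -[leLHS]expRK ler_ln ?posrE ?expR_gt0 ?ltr0n// hN.
Qed.

(** If [B n] were below 1, its defining equation would force kn^2 <= 2 pi e, so [B n >= 1] once [kn]
    exceeds [K]. Then exp(B^2) <= kn^2 <= C^2 (log n)^(2 d0) <= C^2 log n, since d0 < 1/2, and
    taking logarithms gives the upper bound. *)
Lemma threshold_bound (kn : nat -> nat) (B : nat -> R) (d0 x : R) (k : nat) :
  0 < d0 < 1 / 2 ->
  asymp_eq (fun n => (kn n)%:R) (fun n => ln n%:R `^ d0) ->
  (forall n, 0 <= B n /\
     2 * pi * B n ^+ 2 * expR (B n ^+ 2) = (kn n)%:R ^+ 2) ->
  exists (N : nat) (M : R), 0 <= M /\ forall n, (N <= n)%N ->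
    [/\ (0 < n)%N, x <= n%:R, (k <= kn n)%N & [/\ 1 <= B n,
        1 <= ln (ln n%:R : R) & B n <= M * Num.sqrt (ln (ln n%:R))]].
Proof.
move=> /andP[d00 d01] [c [C [c0 C0 [N1 _ hN1]]]] hB.
pose K : R := 2 * pi * expR 1 + k%:R + 1.
have pi2 := @pi_ge2 R.
have e1 : 1 <= expR 1 :> R by apply: le_trans (expR_ge1Dx 1); rewrite lerDl.
have K1 : 1 <= K by rewrite lerDr addr_ge0// !mulr_ge0// pi_ge0.
have K0 : 0 < K by exact: lt_le_trans K1.
have [N2 hN2] := natr_eventually_ge x.
have [N3 hN3] := le_ln_eventually ((K / c) `^ (d0^-1)).
have [N4 hN4] := le_ln_eventually (expR 1).
pose M := Num.sqrt (`|ln (C ^+ 2)| + 1).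
exists (maxn (maxn N1 N2) (maxn N3 N4)), M; split; first by rewrite sqrtr_ge0.
move=> n; rewrite !geq_max => /andP[/andP[n1 n2] /andP[n3 n4]].
have [n0 hK] := hN3 n n3; have [_ he] := hN4 n n4.
have ln_e : 1 <= ln (n%:R : R) by exact: le_trans he.
have ln0 : 0 < ln (n%:R : R) by exact: lt_le_trans ln_e.
have LL : 1 <= ln (ln n%:R : R) by rewrite -[leLHS]expRK ler_ln ?posrE ?expR_gt0.
have /andP[kc kC] := hN1 n n1.
have knK : K <= (kn n)%:R.
  apply: le_trans kc; rewrite mulrC -ler_pdivrMr//.
  have Kc : 0 <= K / c by rewrite divr_ge0// ltW.
  have -> : K / c = ((K / c) `^ d0^-1) `^ d0.
    by rewrite -powRrM mulVf ?gt_eqF// powRr1.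
  by rewrite ge0_ler_powR ?nnegrE ?powR_ge0 ?(ltW d00) ?(ltW ln0).
have [B0 BE] := hB n.
have B1 : 1 <= B n.
  rewrite leNgt; apply/negP => B1.
  have : 2 * pi * B n ^+ 2 * expR (B n ^+ 2) <= 2 * pi * expR 1.
    have b1 : B n ^+ 2 <= 1 by rewrite exprn_ile1// ltW.
    rewrite ler_pM ?expR_ge0 ?mulr_ge0 ?pi_ge0 ?sqr_ge0 ?ler_expR//.
    by rewrite ler_piMr// mulr_ge0// pi_ge0.
  rewrite BE; apply/negP; rewrite -ltNge.
  have k2 : (kn n)%:R <= (kn n)%:R ^+ 2 :> R.
    by rewrite expr2 ler_peMl// (le_trans K1).
  apply: lt_le_trans k2; apply: lt_le_trans knK.
  by rewrite /K -addrA ltrDl ltr_wpDl.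
split => //.
- exact: hN2.
- rewrite -(ler_nat R); apply: le_trans knK; rewrite /K addrAC lerDr.
  by rewrite addr_ge0// !mulr_ge0// ?pi_ge0// expR_ge0.
split => //.
have eB : expR (B n ^+ 2) <= C ^+ 2 * ln n%:R.
  apply: (@le_trans _ _ ((kn n)%:R ^+ 2)).
    rewrite -BE ler_peMl ?expR_ge0// -[leLHS]mulr1 ler_pM//.
      by rewrite -[leLHS]mulr1 ler_pM// ?(le_trans _ pi2)// ler1n.
    by rewrite exprn_ege1.
  apply: (@le_trans _ _ ((C * ln n%:R `^ d0) ^+ 2)).
    by rewrite lerXn2r ?nnegrE// mulr_ge0 ?powR_ge0// ltW.
  rewrite exprMn ler_wpM2l ?sqr_ge0// -powR_mulrn ?powR_ge0// -powRrM.
  rewrite -[leRHS]powRr1 ?(ltW ln0)// ler_powR//; lra.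
rewrite -(@ler_pXn2r _ 2) ?nnegrE ?mulr_ge0 ?sqrtr_ge0//.
rewrite exprMn !sqr_sqrtr ?addr_ge0// ?(le_trans _ LL)//.
have C2 : 0 < C ^+ 2 by rewrite exprn_gt0.
have h : B n ^+ 2 <= ln (C ^+ 2) + ln (ln n%:R).
  rewrite -lnM ?posrE// -[leLHS]expRK ler_ln ?posrE ?expR_gt0 ?mulr_gt0//.
apply: (le_trans h); rewrite mulrDl mul1r lerD2r.
apply: le_trans (ler_norm _) _; rewrite ler_peMr//.
Qed.

(* With [x = n delta^2], the signal [S] is at least [Gam x], while every other
   term of the comparison is at most a constant times [x] or [sqrt S]. *)
Lemma margin (s D S x p q Gam thr : R) :
  0 <= p -> 1 <= x -> Gam * x <= S -> 4 * p ^+ 2 + 2 * q + 1 <= Gam -> 0 <= q ->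
  5 * Num.sqrt (s * D) + thr <= q * x ->
  thr <= S - p * Num.sqrt S - 5 * Num.sqrt (s * D).
Proof.
move=> p0 x1 hS hG q0 hq.
have S0 : 0 <= S.
  apply: le_trans hS; rewrite mulr_ge0//; last exact: le_trans x1.
  by apply: le_trans hG; rewrite !addr_ge0 ?mulr_ge0 ?sqr_ge0.
(* Half of [S] pays for the term in sqrt S, because 4 p^2 <= Gam <= S; the other half pays for the
   terms of order x, because 2 q <= Gam. *)
have hp : p * Num.sqrt S <= S / 2.
  have -> : S / 2 = (Num.sqrt S / 2) * Num.sqrt S by rewrite mulrAC -expr2 sqr_sqrtr.
  rewrite ler_wpM2r ?sqrtr_ge0// ler_pdivlMr//.
  rewrite -(@ler_pXn2r _ 2) ?nnegrE ?mulr_ge0 ?sqrtr_ge0// sqr_sqrtr//.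
  apply: le_trans hS; rewrite -[leLHS]mulr1 ler_pM ?sqr_ge0//.
  by apply: le_trans hG; rewrite exprMn; lra.
have hqx : q * x <= S / 2.
  rewrite ler_pdivlMr//; apply: le_trans hS; rewrite mulrAC ler_wpM2r ?(le_trans _ x1)//.
  by apply: le_trans hG; have := sqr_ge0 p; lra.
lra.
Qed.

End thresholds.

(** * Power of the test *)

Lemma scaled_gram (R : rcfType) n (A : 'M[R]_n) : (0 < n)%N ->
  A^T *m A = n%:R%:M ->
  ((Num.sqrt n%:R)^-1 *: A)^T *m ((Num.sqrt n%:R)^-1 *: A) = 1%:M.
Proof.
move=> n0 h; have nR : (0 : R) < n%:R by rewrite ltr0n.
have -> : ((Num.sqrt n%:R)^-1 *: A)^T = (Num.sqrt n%:R)^-1 *: A^T.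
  by apply/matrixP => i j; rewrite !mxE.
rewrite -scalemxAl -scalemxAr scalerA h scale_scalar_mx -expr2 exprVn sqr_sqrtr ?ltW//.
by rewrite mulVf// gt_eqF.
Qed.

Section normalized_design.
Context d (T : measurableType d) (R : realType) (P : probability T R).
Variables (X : nat -> T -> R -> R) (eps : nat -> {RV P >-> R}) (n : nat).
Variable phi : nat -> T -> R -> R.
Hypothesis XE : flm_design X eps.
Hypothesis mphi : forall v, (1 <= v)%N -> process_measurable (sample_events X n) (phi v).
Hypothesis n0 : (0 < n)%N.
Notation SX := (g_sigma_algebraType (sample_events X n)).

Let Om w := Omega X n phi w.

(** A single function of the sample whose vanishing encodes all the orthogonality equations, so that
    the indicator in [ortho_design] is measurable for the sample. *)
Let defect w : R := \sum_i \sum_j (((Om w)^T *m Om w) i j - (n%:R%:M : 'M[R]_n) i j) ^+ 2.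

(* [Omega / sqrt n], replaced by [0] on the null event where it is not
   orthogonal, so that it is bounded everywhere. *)
Definition ortho_design w : 'M[R]_n :=
  (\1_[set w | defect w = 0] w / Num.sqrt n%:R) *: Om w.

Let defect_eq0 w : defect w = 0 -> (Om w)^T *m Om w = n%:R%:M.
Proof.
move=> /eqP; rewrite psumr_eq0; last first.
  by move=> i _; rewrite sumr_ge0// => j _; rewrite sqr_ge0.
move=> /allP h; apply/matrixP => i j.
have /implyP/(_ isT) := h i (mem_index_enum i).
rewrite psumr_eq0; last by move=> l _; rewrite sqr_ge0.
by move=> /allP/(_ j (mem_index_enum j))/implyP/(_ isT); rewrite sqrf_eq0 subr_eq0 => /eqP.
Qed.

Lemma ortho_designE w : (Om w)^T *m Om w = n%:R%:M ->
  ortho_design w = (Num.sqrt n%:R)^-1 *: Om w.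
Proof.
move=> h; rewrite /ortho_design indicE mem_set ?mul1r//=.
by rewrite /defect h big1// => i _; rewrite big1// => j _; rewrite subrr expr0n.
Qed.

Lemma ortho_designP w : (ortho_design w)^T *m ortho_design w = 1%:M \/ ortho_design w = 0.
Proof.
have [h|h] := pselect (defect w = 0).
  left; rewrite (ortho_designE (defect_eq0 h)).
  exact: (scaled_gram n0 (defect_eq0 h)).
by right; rewrite /ortho_design indicE memNset// mul0r scale0r.
Qed.

Lemma measurable_ortho_design i v :
  measurable_fun setT ((fun w => ortho_design w i v) : SX -> R).
Proof.
have mO (l u : 'I_n) : measurable_fun setT ((fun w => Om w l u) : SX -> R).
  under eq_fun do rewrite mxE.
  by apply: (measurable_Omega_entry XE) => //; exact: mphi.
have md : measurable_fun setT (defect : SX -> R).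
  apply: measurable_sum => l; apply: measurable_sum => u; apply: measurable_funX.
  apply: measurable_funB => //; under eq_fun do rewrite mxE.
  apply: measurable_sum => t; apply: measurable_funM; last exact: mO.
  by under eq_fun do rewrite mxE; exact: mO.
under eq_fun do rewrite mxE.
apply: measurable_funM; last exact: mO.
apply: measurable_funM => //; apply: (@measurable_indic _ SX R).
rewrite (_ : [set w | defect w = 0] = setT `&` (defect @^-1` [set 0])); last by rewrite setTI.
exact: (md measurableT [set 0] (measurable_set1 0)).
Qed.

Lemma Omega_orthogonal w :
  (forall i nu, (i < n)%N -> (1 <= nu)%N -> integrable01 (fun t => X i w t * phi nu w t)) ->
  (forall nu mu, (1 <= nu <= n)%N -> (1 <= mu <= n)%N ->
     Vhat X n w (phi nu w) (phi mu w) = (nu == mu)%:R) ->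
  (Om w)^T *m Om w = n%:R%:M.
Proof.
move=> hi hV; have nR : (n%:R : R) != 0 by rewrite pnatr_eq0 -lt0n.
apply/matrixP => u v; rewrite !mxE.
have := hV u.+1 v.+1 (ltn_ord u) (ltn_ord v).
rewrite VhatE; [|by move=> i ilt; exact: hi|by move=> i ilt; exact: hi].
rewrite eqSS val_eqE => h.
have -> : \sum_j (Om w)^T u j * Om w j v =
    \sum_(i < n) inner01 (X i w) (phi u.+1 w) * inner01 (X i w) (phi v.+1 w).
  by apply: eq_bigr => i _; rewrite !mxE.
rewrite -[LHS](mulVKf nR) h; case: eqVneq => _; by rewrite ?mulr1n ?mulr0n ?mulr1 ?mulr0.
Qed.

End normalized_design.

Lemma le_bigmax_seq_in (R : realDomainType) (s : seq nat) (F : nat -> R) (x : R) j :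
  j \in s -> F j <= \big[Num.max/x]_(i <- s) F i.
Proof.
elim: s => // i s IH; rewrite in_cons big_cons le_max => /orP[/eqP->|/IH->].
  by rewrite lexx.
by rewrite orbT.
Qed.

Section rejection.
Context (R : realType) (c0 : R) (n k kn : nat) (Bn alpha : R).

Lemma sum_dpen_sq_gt0 : (0 < n)%N -> 0 < \sum_(v < n) dpen c0 n k v.+1 ^+ 2.
Proof.
case: n => // m _; rewrite big_ord_recl ltr_wpDr//.
  by rewrite sumr_ge0// => v _; rewrite sqr_ge0.
by rewrite exprn_gt0// dpen_gt0// lambda_ge0.
Qed.

Lemma tau_ge (Om U : 'M[R]_n) (Y : 'cV[R]_n) (thr : R) : (0 < n)%N ->
  U = (Num.sqrt n%:R)^-1 *: Om ->
  thr * Num.sqrt (2 * \sum_(v < n) dpen c0 n k v.+1 ^+ 2) <=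
    \sum_(v < n) dpen c0 n k v.+1 * ((\sum_i U i v * Y i 0) ^+ 2 - 1) ->
  thr <= tau c0 k Om Y.
Proof.
move=> n0 UE h; have nR : (0 : R) < n%:R by rewrite ltr0n.
have D0 := sum_dpen_sq_gt0 n0.
rewrite /tau PLRT_sum// !big_add1/= !big_mkord.
rewrite ler_pdivlMr ?sqrtr_gt0 ?mulr_gt0//; apply: le_trans h _.
rewrite le_eqVlt; apply/orP; left; apply/eqP; rewrite -sumrB; apply: eq_bigr => v _.
have -> : \sum_i U i v * Y i 0 = (Num.sqrt n%:R)^-1 * \sum_i Om i v * Y i 0.
  by rewrite mulr_sumr; apply: eq_bigr => i _; rewrite UE mxE mulrA.
rewrite exprMn exprVn sqr_sqrtr ?ltW//; field; exact: lt0r_neq0.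
Qed.

(** As [Bn >= 1], multiplying the positive excess of the maximum over [Bn] by [Bn] only enlarges
    it. *)
Lemma AT_gt_crit (Om : 'M[R]_n) (Y : 'cV[R]_n) : (1 <= k <= kn)%N -> 1 <= Bn ->
  Bn + `|crit alpha| + 1 <= tau c0 k Om Y -> crit alpha < AT c0 kn Bn Om Y.
Proof.
move=> kkn B1 h; rewrite /AT.
have hA : Bn + `|crit alpha| + 1 <= ATstar c0 kn Om Y.
  by apply: le_trans h _; apply: le_bigmax_seq_in; rewrite mem_index_iota ltnS.
apply: (@lt_le_trans _ _ (`|crit alpha| + 1)).
  by apply: le_lt_trans (ler_norm _) _; rewrite ltrDl.
apply: (@le_trans _ _ (ATstar c0 kn Om Y - Bn)); first lra.
by rewrite ler_peMl//; have := normr_ge0 (crit alpha); lra.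
Qed.

End rejection.

Lemma rejection_probability (R : realType) (d : measure_display) (T : measurableType d)
    (P : probability T R) (X : nat -> T -> R -> R) (eps : nat -> {RV P >-> R})
    (n : nat) (phi : nat -> T -> R -> R) (c0 : R) (kn k : nat) (Bn alpha s : R)
    (b : nat -> R) (beta : T -> R -> R) :
  let D := \sum_(v < n) dpen c0 n k v.+1 ^+ 2 in
  let S := \sum_(v < n) dpen c0 n k v.+1 * (Num.sqrt n%:R * b v.+1) ^+ 2 in
  flm_design X eps -> empirical_eigenfunctions P X n phi ->
  (0 < n)%N -> (1 <= k <= kn)%N -> 1 <= Bn -> 0 < s -> 0 < S ->
  (l2norm_wt k b <= 1)%E -> slope_sum P X n phi b beta ->
  (Bn + `|crit alpha| + 1) * Num.sqrt (2 * D) <=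
    S - (2 * Num.sqrt s + 4) * Num.sqrt S - 5 * Num.sqrt (s * D) ->
  ((1 - (3 * (centered_sq R + 2) + 2) / s)%:E <=
    P (reject X eps n phi c0 kn Bn alpha beta))%E.
Proof.
move=> D S XE [mphi aephi] n0 kkn B1 s0 S0 bk [mbeta aebeta] hmargin.
have nR : (0 : R) < n%:R by rewrite ltr0n.
have l0 := lambda_ge0 c0 n k.
pose dd (v : 'I_n) := dpen c0 n k v.+1.
pose m (v : 'I_n) := Num.sqrt n%:R * b v.+1.
have dd01 v : 0 <= dd v <= 1 by rewrite ltW ?dpen_gt0// dpen_le1.
have D0 : 0 < D by exact: sum_dpen_sq_gt0.
(* As d_v <= 1, the variance of the linear form is at most the signal itself; [S] thus serves as its
   scale in [chaos_tail]. *)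
have cS : \sum_v (dd v * m v) ^+ 2 <= S.
  apply: ler_sum => v _; rewrite exprMn ler_wpM2r ?sqr_ge0//.
  by case/andP: (dd01 v) => ? ?; rewrite expr2 ler_piMr.
have mU := measurable_ortho_design XE mphi.
have hU w : (ortho_design X n phi w)^T *m ortho_design X n phi w = 1%:M \/
    ortho_design X n phi w = 0 by exact: ortho_designP.
have [A mA [PA hA]] := chaos_tail XE mU hU S0 D0 cS (lexx D) s0.
have mRj := measurable_reject XE c0 Bn alpha kn n0 mphi mbeta.
move: (aephi) (aebeta) => [N1 [mN1 PN1 hN1]] [N2 [mN2 PN2 hN2]].
set Rj := reject _ _ _ _ _ _ _ _ _ in mRj *.
have sub : ~` Rj `<=` A `|` (N1 `|` N2).
  move=> w; apply: contra_notP => /not_orP[nA /not_orP[nN1 nN2]].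
  have [hi hV1 hV2] : [/\ forall i nu, (i < n)%N -> (1 <= nu)%N ->
          integrable01 (fun t => X i w t * phi nu w t),
        forall nu mu, (1 <= nu <= n)%N -> (1 <= mu <= n)%N ->
          Vhat X n w (phi nu w) (phi mu w) = (nu == mu)%:R
      & forall nu, (n < nu)%N -> Vhat X n w (phi nu w) (phi nu w) <= 1].
    by apply: contrapT => h; apply: nN1; exact: hN1.
  have [hbeta hrest] : (forall i, (i < n)%N -> integrable01 (fun t => X i w t * beta w t)) /\
    (let rest m t := beta w t - \sum_(1 <= nu < m.+1) b nu * phi nu w t in
     (fun m => Vhat X n w (rest m) (rest m)) @ \oo --> (0 : R)).
    by apply: contrapT => h; apply: nN2; exact: hN2.
  have [hL hVt hQ] := hA w nA.
  have OO := Omega_orthogonal n0 hi hV1.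
  have UE := ortho_designE OO.
  have UU : (ortho_design X n phi w)^T *m ortho_design X n phi w = 1%:M.
    by rewrite UE; exact: (scaled_gram n0 OO).
  set U := ortho_design X n phi w in UE UU.
  pose tail (i : 'I_n) := inner01 (X i w) (beta w) -
    \sum_(1 <= v < n.+1) b v * inner01 (X i w) (phi v w).
  have tail4 : \sum_i tail i ^+ 2 <= 4.
    have /andP[k1 _] := kkn.
    by apply: (tail_sq_le4 n0 k1 hi hV2 hbeta hrest) => m'; exact: l2norm_wt_le1.
  have YE i : responses X n eps (beta) w i 0 = \sum_u m u * U i u + tail i + eps i w.
    have -> : \sum_u m u * U i u = \sum_(1 <= v < n.+1) b v * inner01 (X i w) (phi v w).
      rewrite big_add1 big_mkord; apply: eq_bigr => v _; rewrite UE !mxE /m; field.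
      by rewrite gt_eqF// sqrtr_gt0.
    by rewrite mxE /tail subrKC.
  apply: (AT_gt_crit kkn B1); apply: (tau_ge n0 UE).
  apply: (le_trans hmargin).
  under [leRHS]eq_bigr => v _ do under eq_bigr => i _ do rewrite YE.
  apply: (@statistic_lower_bound R n U m tail (fun i => eps i w) dd s D UU tail4 dd01 (ltW s0)).
  - exact: ltW.
  - exact: ltW.
  - by rewrite (sum_sq_centered dd (fun i => eps i w) UU); exact: ltW.
have PNN : P (N1 `|` N2) = 0%E.
  apply/eqP; rewrite -measure_le0; apply: le_trans (measureU2 _ _ _) _ => //.
  by rewrite -[leRHS]adde0; apply: leeD; rewrite le_eqVlt; apply/orP; left; apply/eqP.
have PC : (P (~` Rj) <= ((3 * (centered_sq R + 2) + 2) / s)%:E)%E.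
  have mN : measurable (N1 `|` N2) by exact: measurableU.
  apply: (@le_trans _ _ (P (A `|` (N1 `|` N2)))).
    by apply: le_measure => //; rewrite inE; [exact: measurableC|exact: measurableU].
  apply: le_trans (measureU2 _ _ _) _ => //.
  rewrite -[leRHS]adde0; apply: leeD => //.
  by rewrite le_eqVlt; apply/orP; left; apply/eqP.
have : (P (~` Rj) = 1 - P Rj)%E by exact: probability_setC.
move: PC => /[swap] ->.
have Pf : P Rj \is a fin_num by exact: fin_num_measure.
by rewrite -(fineK Pf) -EFinB !lee_fin lerBlDr lerBlDl addrC.
Qed.

Theorem theorem6p2 (R : realType) (d : measure_display) (T : measurableType d)
    (P : probability T R)
    (X : nat -> T -> R -> R) (eps : nat -> {RV P >-> R})
    (phi : nat -> nat -> T -> R -> R)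
    (c0 : R) (kn : nat -> nat) (B : nat -> R) (d0 : R) (alpha : R) (k : nat) :
  flm_design X eps ->
  (forall n, (1 <= n)%N -> empirical_eigenfunctions P X n (phi n)) ->
  0 < c0 ->
  0 < d0 < 1 / 2 ->
  asymp_eq (fun n => (kn n)%:R) (fun n => ln n%:R `^ d0) ->
  (forall n, 0 <= B n /\
     2 * pi * B n ^+ 2 * expR (B n ^+ 2) = (kn n)%:R ^+ 2) ->
  0 < alpha < 1 ->
  (1 <= k)%N ->
  forall e : R, 0 < e < 1 ->
  exists (N : nat) (C : R), [/\ (0 < N)%N, 0 < C &
    forall n, (N <= n)%N ->
      ((1 - e)%:E <=
        ereal_inf [set p | exists (b : nat -> R) (beta : T -> R -> R),
          [/\ (C * delta R n k)%:E <= l2norm b,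
              l2norm_wt k b <= 1,
              slope_sum P X n (phi n) b beta
            & p = P (reject X eps n (phi n) c0 (kn n) (B n) alpha beta)]])%E].
Proof.
move=> XE PH c00 d0h kna hB _ k0 e /andP[e0 e1].
(* The constant of [chaos_tail]; s = kap / e makes the failure probability equal to e. *)
pose kap : R := 3 * (centered_sq R + 2) + 2.
have kap0 : 0 < kap by rewrite /kap; have := centered_sq_ge0 R; lra.
pose s := kap / e.
have s0 : 0 < s by rewrite divr_gt0.
have [N [M [M0 hN]]] := threshold_bound (c0 ^+ (4 * k + 1)) k d0h kna hB.
pose r := `|crit alpha|.
have r0 : 0 <= r by exact: normr_ge0.
pose p := 2 * Num.sqrt s + 4.
have p0 : 0 <= p by rewrite addr_ge0// mulr_ge0// sqrtr_ge0.
(* The noise and threshold terms in units of x: both summands use (sum d_v^2) log log n <= (3 / c0)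
   x^2, the second also [B n <= M] sqrt(log log n). *)
pose q := 5 * Num.sqrt (s * (3 / c0)) + (M + r + 1) * Num.sqrt (2 * (3 / c0)).
have q0 : 0 <= q.
  by rewrite addr_ge0// mulr_ge0 ?sqrtr_ge0// addr_ge0// addr_ge0.
pose Gam := 4 * p ^+ 2 + 2 * q + 1.
have Gam1 : 1 <= Gam by rewrite /Gam; have := sqr_ge0 p; lra.
(* After multiplication by n, [signal_lower_bound] leaves C^2 x minus the losses n lambda_k =
   c0^(2k) x and n n^(-2k) <= 1 <= x, so that Gam x remains. *)
pose C := Num.sqrt (Gam + c0 ^+ (2 * k) + 1).
have ck0 : 0 < c0 ^+ (2 * k) by rewrite exprn_gt0.
exists (maxn N 1), C; split; first by rewrite leq_maxr.
  by rewrite sqrtr_gt0; lra.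
move=> n; rewrite geq_max => /andP[Nn _].
have [n0 cn kkn [B1 L1 BM]] := hN n Nn.
apply: le_ereal_inf_tmp => _ [b [beta [tb bk hbeta ->]]].
have [a [l [a1 l1 [na Ll dE lamE h1]]]] := rate_monomials c00 n0 L1 cn.
have a0 : 0 < a by exact: lt_le_trans a1.
have l0 : 0 < l by exact: lt_le_trans l1.
have nR : (0 : R) < n%:R by rewrite ltr0n.
pose x := a * l ^+ (2 * k).
have x1 : 1 <= x by rewrite -[leLHS]mulr1 ler_pM// exprn_ege1.
have x0 : 0 < x by exact: lt_le_trans x1.
pose D := \sum_(v < n) dpen c0 n k v.+1 ^+ 2.
pose S := \sum_(v < n) dpen c0 n k v.+1 * (Num.sqrt n%:R * b v.+1) ^+ 2.
have k4 : (4 * k + 1 = 2 * k + 2 * k + 1)%N by rewrite -mulnDl.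
have aE : a ^+ (4 * k + 1) = a ^+ (2 * k) * a ^+ (2 * k) * a.
  by rewrite k4 !exprD expr1.
have lE : l ^+ (4 * k + 1) = l ^+ (2 * k) * l ^+ (2 * k) * l.
  by rewrite k4 !exprD expr1.
have ak0 : 0 < a ^+ (2 * k) by rewrite exprn_gt0.
have lk0 : 0 < l ^+ (2 * k) by rewrite exprn_gt0.
have delta0 : 0 <= delta R n k by rewrite dE divr_ge0 ?exprn_ge0 ?(ltW a0) ?(ltW l0).
have C0 : 0 <= C by exact: sqrtr_ge0.
have nx : n%:R * delta R n k ^+ 2 = x.
  have lk2 : (l ^+ k) ^+ 2 = l ^+ (2 * k) by rewrite -exprM mulnC.
  rewrite dE na aE exprMn exprVn lk2 /x.
  move: (a ^+ (2 * k)) (l ^+ (2 * k)) ak0 => u v u0; field.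
  by rewrite gt_eqF.
have nlam : n%:R * lambda_ c0 n k = c0 ^+ (2 * k) * x.
  rewrite lamE na aE exprMn exprVn exprMn exprAC /x.
  move: (a ^+ (2 * k)) (l ^+ (2 * k)) (c0 ^+ (2 * k)) ak0 => u v y u0; field.
  by rewrite gt_eqF.
have nn : n%:R * (n%:R ^+ (2 * k))^-1 <= 1 :> R.
  rewrite ler_pdivrMr ?exprn_gt0// mul1r -{1}[n%:R]expr1 ler_weXn2l ?ler1n//.
  by rewrite muln_gt0.
have SE : S = n%:R * \sum_(v < n) dpen c0 n k v.+1 * b v.+1 ^+ 2.
  rewrite mulr_sumr; apply: eq_bigr => v _.
  by rewrite exprMn sqr_sqrtr ?ltW// mulrCA.
have hS : Gam * x <= S.
  have := signal_lower_bound c0 n0 (mulr_ge0 C0 delta0) tb bk.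
  rewrite -(ler_pM2l nR) !mulrDr -SE nlam exprMn [n%:R * _]mulrCA nx sqr_sqrtr; last lra.
  by rewrite !mulrDl mul1r => hs; lra.
have S0 : 0 < S by apply: lt_le_trans hS; rewrite mulr_gt0// (lt_le_trans _ Gam1).
pose h := c0 * l / a ^+ 2.
have h0 : 0 < h by rewrite divr_gt0 ?mulr_gt0 ?exprn_gt0.
(* Here 1 / h = a^2 / (c0 l) and log log n = l^(4k+1), whose product is a^2 l^(4k) / c0 = x^2 /
   c0. *)
have DL : D * ln (ln n%:R) <= 3 / c0 * x ^+ 2.
  have -> : 3 / c0 * x ^+ 2 = 3 / h * ln (ln n%:R).
    rewrite Ll lE /h /x; move: (l ^+ (2 * k)) => v; field.
    by rewrite !gt_eqF.
  by rewrite ler_wpM2r ?(le_trans _ L1)//; exact: sum_dpen_sq_le.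
have D0 : 0 <= D by rewrite sumr_ge0// => v _; rewrite sqr_ge0.
have D1 : D <= 3 / c0 * x ^+ 2 by apply: le_trans DL; rewrite ler_peMr.
have sqrt_x (u v : R) : 0 <= u -> v <= u * x ^+ 2 -> Num.sqrt v <= Num.sqrt u * x.
  move=> u0 uv; apply: le_trans (ler_wsqrtr uv) _.
  by rewrite sqrtrM// sqrtr_sqr ger0_norm// ltW.
have c30 : 0 <= 3 / c0 by rewrite divr_ge0// ltW.
have -> : 1 - e = 1 - (3 * (centered_sq R + 2) + 2) / s.
  by rewrite /s -/kap; field; rewrite !gt_eqF.
apply: (@rejection_probability R d T P X eps n (phi n) c0 (kn n) k (B n) alpha s b beta) => //.
- exact: PH.
- by rewrite k0.
apply: (@margin R s D S x p q Gam) => //.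
rewrite /q [leRHS]mulrDl lerD//.
  rewrite -[leRHS]mulrA ler_wpM2l//; apply: sqrt_x; first by rewrite mulr_ge0// ltW.
  by rewrite -[leRHS]mulrA ler_wpM2l// ltW.
have L0 : 0 <= ln (ln n%:R) :> R by exact: le_trans L1.
have sL1 : 1 <= Num.sqrt (ln (ln n%:R)) :> R by rewrite -[leLHS]sqrtr1 ler_wsqrtr.
(* The constant part |crit| + 1 of the threshold is absorbed by sqrt(log log n) >= 1. *)
apply: (@le_trans _ _ ((M + r + 1) * (Num.sqrt (ln (ln n%:R)) * Num.sqrt (2 * D)))).
  rewrite mulrA ler_wpM2r ?sqrtr_ge0// -/r !mulrDl mul1r lerD// lerD//.
  by rewrite ler_peMr.
rewrite -[leRHS]mulrA ler_wpM2l ?addr_ge0 ?addr_ge0// -sqrtrM//.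
apply: sqrt_x; first by rewrite mulr_ge0.
by rewrite mulrCA -[leRHS]mulrA ler_wpM2l// mulrC.
Qed.
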